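(* Assume, in the setting described in the context, that $\sup_{t\in[0,T],x\in\mathbb{R}^d}|c_l(t,x)|<\infty$ for every $l\in\mathcal{L}_m$ and that $\phi$ is bounded and Lipschitz ($|\phi(x)-\phi(y)|\le L\|x-y\|$). Then for any $p\ge1$ and $m_0\in\{m,\dots,d\}$ there exists a small enough $T=T(p,m_0)>0$ such that $$\mathbb{E}\Big[\sup_{x\in\mathbb{R}^d}|\mathcal{H}_\phi(\mathcal{T}_{t,x,i})|^p\Big]<\infty,\qquad t\in[0,T],\ i=0,\dots,m_0,$$ provided that $$\int_0^T\frac{ds}{\rho^{p-1}(s)}<\infty\quad\text{and}\quad\int_0^T\!\!\int_0^\infty\frac{e^{-s\eta(\lambda)}}{\rho^{p-1}(s)}\lambda^{p/2-1}\,d\lambda\,ds<\infty.$$ When $p=1$, both of these conditions are satisfied if $\int_{\lambda_0}^\infty\frac{d\lambda}{\eta(\lambda)\sqrt{\lambda}}<\infty$ for some $\lambda_0>0$.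
   Context: Setting: $d\ge1$, $T>0$, $\eta:(0,\infty)\to[0,\infty)$ a Bernstein function with $\eta(0^+)=0$; a subordinator with Laplace exponent $\eta$ satisfies $\mathbb{E}[e^{-\lambda S_t}]=e^{-t\eta(\lambda)}$. $m\in\{0,\dots,d\}$, $\mathcal{L}_m\subset\mathbb{N}^{m+1}$ finite, $c_l:[0,T]\times\mathbb{R}^d\to\mathbb{R}$ measurable for $l\in\mathcal{L}_m$, $\phi:\mathbb{R}^d\to\mathbb{R}$. Random marked tree: let $\rho$ be a probability density on $\mathbb{R}_+$ with $\rho>0$, and $\bar F(z):=\int_z^\infty\rho(s)ds$. Let $(q_l)_{l\in\mathcal{L}_m}$ be a probability mass function on $\mathcal{L}_m$ with $q_l>0$ for all $l$ and $\sum_l|l|q_l<\infty$, where $|l|=l_0+\dots+l_m$. For $t\in[0,T]$, $x\in\mathbb{R}^d$, $i\in\{0,\dots,d\}$, the tree $\mathcal{T}_{t,x,i}$ is built as follows. The root particle is born at time $t$ at position $x$ with mark $i$. Each particle $k$, born at time $T_{k-}$ at position $X^k_{T_{k-}}$ with mark $\theta_k$, has a lifetime $\tau_k$ with density $\rho$, death time $T_k=T_{k-}+\tau_k$, its own subordinator $S^k$ with Laplace exponent $\eta$ and standard $d$-dimensional Brownian motion $B^k$, and moves as $X^k_s=X^k_{T_{k-}}+B^k_{S^k_{s-T_{k-}}}$ for $s\ge T_{k-}$ (up to $\min(T_k,T)$). If $T_k<T$, an index $I_k=(l_0,\dots,l_m)\in\mathcal{L}_m$ is drawn with probability $q_{l}$,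 and the particle is replaced by $|l|$ offspring born at time $T_k$ at position $X^k_{T_k}$: $l_0$ of them with mark $0$, $l_1$ with mark $1$, ..., $l_m$ with mark $m$. If $T_k\ge T$, the particle is stopped at time $T$ and has no offspring. All lifetimes, indices, subordinators and Brownian motions are mutually independent. $\mathcal{K}^\circ$ denotes the set of particles with $T_k<T$ and $\mathcal{K}^\partial$ those with $T_k\ge T$. Weights: $\mathcal{W}_k=1$ if $\theta_k=0$; if $\theta_k\neq0$, $\mathcal{W}_k=(X^k_{T_k}-X^k_{T_{k-}})_{\theta_k}/S^k_{T_k-T_{k-}}$ for $k\in\mathcal{K}^\circ$ and $\mathcal{W}_k=(X^k_{T}-X^k_{T_{k-}})_{\theta_k}/S^k_{T-T_{k-}}$ for $k\in\mathcal{K}^\partial$, where $(v)_j$ is the $j$-th coordinate. The functional is $$\mathcal{H}_\phi(\mathcal{T}_{t,x,i})=\prod_{k\in\mathcal{K}^\circ}\frac{c_{I_k}(T_k,X^k_{T_k})\mathcal{W}_k}{q_{I_k}\rho(\tau_k)}\prod_{k\in\mathcal{K}^\partial}\frac{\big(\phi(X^k_T)-\phi(X^k_{T_{k-}})\mathbf{1}_{\{\theta_k\neq0\}}\big)\mathcal{W}_k}{\bar F(T-T_{k-})}.$$ *)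

(* Defs.v *)
From HB Require Import structures.
From mathcomp Require Import all_boot all_order all_algebra.
From mathcomp Require Import all_classical all_reals all_analysis.
Set Implicit Arguments. Unset Strict Implicit. Unset Printing Implicit Defensive.
Import Order.TTheory GRing.Theory Num.Theory.
Import numFieldNormedType.Exports.
Local Open Scope classical_set_scope.
Local Open Scope ring_scope.

Section Defs.
Variable R : realType.

Definition bernstein (eta : R -> R) : Prop :=
  [/\ (forall x, 0 < x -> 0 <= eta x),
      (forall (n : nat) x, 0 < x -> derivable (derive1n n eta) x 1) &
      (forall (n : nat) x, 0 < x -> 0 <= (-1) ^+ n * derive1n n.+1 eta x)].

Definition enorm (d : nat) (v : 'rV[R]_d) : R := Num.sqrt (\sum_(k < d) v 0 k ^+ 2).

Definition vcoord (d : nat) (v : 'rV[R]_d) (j : nat) : R :=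
  if @insub _ (fun k => (k < d)%N) 'I_d j is Some k then v 0 k else 0.

Definition borel_mble (X : topologicalType) (D : set X) (f : X -> R) : Prop :=
  forall B : set R, measurable B -> <<s (@open X) >> (D `&` f @^-1` B).

Definition Fbar (rho : R -> R) (z : R) : R :=
  fine (\int[@lebesgue_measure R]_(s in [set` `[z, +oo[%R]) (rho s)%:E)%E.

Definition pos_density (rho : R -> R) : Prop :=
  [/\ measurable_fun setT rho,
      (forall s, 0 <= s -> 0 < rho s) &
      (\int[@lebesgue_measure R]_(s in [set` `[0, +oo[%R]) (rho s)%:E = 1)%E].

Definition cond_rho (p T : R) (rho : R -> R) : Prop :=
  (\int[@lebesgue_measure R]_(s in [set` `[0, T]%R]) ((powR (rho s) (p - 1))^-1)%:E < +oo)%E.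

Definition cond_eta (p T : R) (rho eta : R -> R) : Prop :=
  (\int[@lebesgue_measure R]_(s in [set` `[0, T]%R])
     (\int[@lebesgue_measure R]_(lam in [set` `]0, +oo[%R])
        (expR (- (s * eta lam)) / powR (rho s) (p - 1) * powR lam (p / 2 - 1))%:E)
   < +oo)%E.

(* int_{lam0}^oo dlam / (eta(lam) sqrt(lam)) < oo, with 1/0 = +oo *)
Definition cond_p1 (eta : R -> R) : Prop :=
  exists lam0 : R, 0 < lam0 /\
  (\int[@lebesgue_measure R]_(lam in [set` `[lam0, +oo[%R])
      ((eta lam * Num.sqrt lam)%:E)^-1 < +oo)%E.

Section Prob.
Context {d0 : measure_display} {Omega : measurableType d0}.
Variable P : probability Omega R.

(* pi-system of events generated by a collection of real random variables *)
Definition rv_events (F : set (Omega -> R)) : set (set Omega) :=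
  [set A | exists (n : nat) (X : 'I_n -> Omega -> R) (B : 'I_n -> set R),
     [/\ (forall k, F (X k)), (forall k, measurable (B k)) &
         A = \bigcap_(k in [set: 'I_n]) (X k @^-1` B k)]].

(* mutual independence of a family of collections of random variables
   (i.e. of the sigma-algebras they generate) *)
Definition mindep (I : eqType) (F : I -> set (Omega -> R)) : Prop :=
  forall (J : seq I) (A : I -> set Omega), uniq J ->
    (forall j, j \in J -> rv_events (F j) (A j)) ->
    P (\bigcap_(j in [set` J]) A j) = (\prod_(j <- J) P (A j))%E.

Definition gauss_pdf (v : R) (y : R) : R :=
  (Num.sqrt (2 * pi * v))^-1 * expR (- (y ^+ 2) / (2 * v)).

Definition gaussian_law (X : Omega -> R) (v : R) : Prop :=
  forall A, measurable A ->
    P (X @^-1` A) = (\int[@lebesgue_measure R]_(y in A) (gauss_pdf v y)%:E)%E.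

Definition density_law (tau : Omega -> R) (rho : R -> R) : Prop :=
  measurable_fun setT tau /\
  forall A, measurable A ->
    P (tau @^-1` A) = (\int[@lebesgue_measure R]_(s in A `&` [set` `[0, +oo[%R]) (rho s)%:E)%E.

Definition incr_times (ts : nat -> R) : Prop :=
  0 <= ts 0%N /\ forall k, ts k <= ts k.+1.

Definition std_BM (d : nat) (B : R -> Omega -> 'rV[R]_d) : Prop :=
  [/\ (forall w, B 0 w = 0),
      (forall w (j : 'I_d), {within [set` `[0, +oo[%R], continuous (fun t => B t w 0 j)}),
      (forall t (j : 'I_d), 0 <= t -> measurable_fun setT (fun w => B t w 0 j)),
      (forall s t (j : 'I_d), 0 <= s < t -> gaussian_law (fun w => (B t w - B s w) 0 j) (t - s)) &
      (forall ts, incr_times ts ->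
         mindep (fun kj : nat * 'I_d =>
           [set (fun w => (B (ts kj.1.+1) w - B (ts kj.1) w) 0 kj.2)]))].

Definition subordinator (eta : R -> R) (S : R -> Omega -> R) : Prop :=
  [/\ (forall w, S 0 w = 0),
      (forall w s t, 0 <= s <= t -> S s w <= S t w),
      (forall w t, 0 <= t -> S t' w @[t' --> t^'+] --> S t w),
      (forall t, 0 <= t -> measurable_fun setT (S t)) &
   [/\
      (forall ts, incr_times ts ->
         mindep (fun k : nat => [set (fun w => S (ts k.+1) w - S (ts k) w)])),
      (forall s t A, 0 <= s <= t -> measurable A ->
         P ((fun w => S t w - S s w) @^-1` A) = P (S (t - s) @^-1` A)) &
      (forall t lam, 0 <= t -> 0 < lam ->
         (\int[P]_w (expR (- (lam * S t w)))%:E)%E = (expR (- (t * eta lam)))%:E)]].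

End Prob.

Section Tree.
Variables (d m : nat).
Notation idx := {ffun 'I_m.+1 -> nat}.

Definition lsize (l : idx) : nat := (\sum_(r < m.+1) l r)%N.

(* mark of the j-th offspring (0-indexed) of a particle with index l:
   the first l_0 offspring have mark 0, the next l_1 mark 1, etc. *)
Definition childmark (l : idx) (j : nat) : nat :=
  #|[set r : 'I_m.+1 | (\sum_(r' < m.+1 | (r' <= r)%N) l r' <= j)%N]|.

Context {d0 : measure_display} {Omega : measurableType d0}.
(* particles are labelled by Ulam-Harris words u : seq nat;
   [:: j1; ...; jn] = the jn-th child of ... of the j1-th child of the root *)
Variables (tau : seq nat -> Omega -> R) (Ix : seq nat -> Omega -> idx)
          (S : seq nat -> R -> Omega -> R) (B : seq nat -> R -> Omega -> 'rV[R]_d).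

(* state of a particle: (in the tree?, birth time, birth position, mark) *)
Definition pstate := (bool * R * 'rV[R]_d * nat)%type.

Definition child (T : R) (u : seq nat) (j : nat) (w : Omega) (st : pstate) : pstate :=
  let: (a, tb, xb, _) := st in
  let td := tb + tau u w in
  (a && (td < T) && (j < lsize (Ix u w))%N, td,
   xb + B u (S u (tau u w) w) w, childmark (Ix u w) j).

Fixpoint walk (T : R) (pre : seq nat) (lab : seq nat) (w : Omega) (st : pstate) : pstate :=
  match lab with
  | [::] => st
  | j :: rest => walk T (rcons pre j) rest w (child T pre j w st)
  end.

Definition pst (T t : R) (x : 'rV[R]_d) (i : nat) (w : Omega) (u : seq nat) : pstate :=
  walk T [::] u w (true, t, x, i).

Definition in_tree (T t : R) (x : 'rV[R]_d) (i : nat) (w : Omega) : set (seq nat) :=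
  [set u | (pst T t x i w u).1.1.1].

Variables (q : idx -> R) (rho : R -> R) (c : idx -> R -> 'rV[R]_d -> R)
          (phi : 'rV[R]_d -> R).

Definition pfactor (T t : R) (x : 'rV[R]_d) (i : nat) (w : Omega) (u : seq nat) : R :=
  let: (_, tb, xb, th) := pst T t x i w u in
  let tk := tau u w in
  let l := Ix u w in
  if tb + tk < T then
    let s := S u tk w in
    let Wk := if th == 0%N then 1 else vcoord (B u s w) th.-1 / s in
    c l (tb + tk) (xb + B u s w) * Wk / (q l * rho tk)
  else
    let s := S u (T - tb) w in
    let Wk := if th == 0%N then 1 else vcoord (B u s w) th.-1 / s in
    (phi (xb + B u s w) - (if th == 0%N then 0 else phi xb)) * Wk / Fbar rho (T - tb).

(* H_phi(T_{t,x,i}); the tree is a.s. finite (fset_set of an infinite set is empty) *)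
Definition Hphi (T t : R) (x : 'rV[R]_d) (i : nat) (w : Omega) : R :=
  \prod_(u <- finmap.enum_fset (fset_set (in_tree T t x i w))) pfactor T t x i w u.

End Tree.

Definition particle_family (d m : nat) (eta : R -> R) (L : seq {ffun 'I_m.+1 -> nat})
  (q : {ffun 'I_m.+1 -> nat} -> R) (rho : R -> R)
  {d0 : measure_display} {Omega : measurableType d0} (P : probability Omega R)
  (tau : seq nat -> Omega -> R) (Ix : seq nat -> Omega -> {ffun 'I_m.+1 -> nat})
  (S : seq nat -> R -> Omega -> R) (B : seq nat -> R -> Omega -> 'rV[R]_d) : Prop :=
  [/\ (forall u, density_law P (tau u) rho),
      (forall u (r : 'I_m.+1), measurable_fun setT (fun w => ((Ix u w r)%:R : R))),
      (forall u l, P (Ix u @^-1` [set l]) = (if l \in L then q l else 0)%:E),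
      (forall u, subordinator P eta (S u)) &
   [/\ (forall u, std_BM P (B u)) &
      mindep P (fun uk : seq nat * 'I_4 =>
        match val uk.2 with
        | 0 => [set tau uk.1]
        | 1 => [set X | exists r : 'I_m.+1, X = (fun w => ((Ix uk.1 w r)%:R : R))]
        | 2 => [set X | exists t, 0 <= t /\ X = S uk.1 t]
        | _ => [set X | exists t (j : 'I_d), 0 <= t /\ X = (fun w => B uk.1 t w 0 j)]
        end)]].

End Defs.

(* Main.v *)
(* Neither the genealogy and the birth times of the tree nor the weights depend
   on x, so |H(x)|^p is bounded, uniformly in x and in the marks, by a product
   over the particles u of r(u), where r(u) depends only on the birth time and
   on the lifetime, subordinator and Brownian motion of u itself.  Let each alive
   particle carry a factor K >= 1, handed on to its offspring.  A finite tree
   has at most one particle more than there are offspring, so the product of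
   the r(u) is at most K times the product of the normalised steps
   r(u) K^(#offspring - 1).  Revealing the particles parents first, the latter
   product is a nonnegative supermartingale as soon as T is small: the leaf part
   of r(u) has bounded mean by Brownian scaling, and the branching part has mean
   O(int_0^T rho^(1-p) (1 + E S_s^(-p/2)) ds), where E S_s^(-p/2) is at most a
   constant times int_0^oo exp(-s eta(lam)) lam^(p/2-1) dlam.  Fatou's lemma
   along an enumeration of the Ulam-Harris words concludes. *)
Require Import Defs.
From HB Require Import structures.
From mathcomp Require Import all_boot all_order all_algebra.
From mathcomp Require Import all_classical all_reals all_analysis.
From mathcomp Require Import measurable_realfun ring lra.
Set Implicit Arguments.
Unset Strict Implicit.
Unset Printing Implicit Defensive.
Import Order.TTheory GRing.Theory Num.Theory.
Import numFieldNormedType.Exports.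
Local Open Scope classical_set_scope.
Local Open Scope ring_scope.

(** * Independence and decoupling *)

(** The weight of a nonzero mark has size |B_S| / S, that is S^(-1/2) after Brownian scaling. At a
    leaf the Lipschitz increment of [phi] supplies a second factor |B_S| and the singularity
    cancels. At a branching it stays, and it has to be averaged over the lifetime; this is where the
    second integral condition enters. This asymmetry fixes the order of the constants. The leaf mean
    is bounded independently of T and determines K. K enters the constant [A1] of the branching part
    through K^|l|. T comes last and makes the branching mean small compared with K. All of them
    precede the probability space, as T does in the statement. Two obstacles shape the
    formalisation. The inputs live on one abstract space and independence is a statement about
    events, so conditioning is replaced by a decoupling identity that turns f(w, w) into a double
    integral of f(w, w'). And the supremum over x is not known to be measurable, so it is only ever
    bounded above, by measurable functions. *)

Definition sigma_type (d0 : measure_display) (Omega : measurableType d0) (C : set (set Omega)) :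
  measurableType C.-sigma := g_sigma_algebraType C.

Section independence.
Context {R : realType} {d0 : measure_display} {Omega : measurableType d0}.
Variable P : probability Omega R.
Implicit Types (F : set (Omega -> R)) (A B : set Omega).

Lemma rv_eventsT F : rv_events F setT.
Proof.
exists 0%N, (fun=> cst 0), (fun=> setT); split => //; first by case.
by apply/esym; rewrite -subTset => w _ [].
Qed.

Lemma rv_events_preimage F X (B : set R) : F X -> measurable B -> rv_events F (X @^-1` B).
Proof.
move=> FX mB; exists 1%N, (fun=> X), (fun=> B); split => //.
by apply/seteqP; split => w; [move=> XBw k _|move/(_ ord0 I)].
Qed.

Lemma rv_eventsI F : setI_closed (rv_events F).
Proof.
move=> _ _ [n1 [X1 [B1 [FX1 mB1 ->]]]] [n2 [X2 [B2 [FX2 mB2 ->]]]].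
exists (n1 + n2)%N,
  (fun k : 'I_(n1 + n2) => match fintype.split k with inl i => X1 i | inr j => X2 j end),
  (fun k : 'I_(n1 + n2) => match fintype.split k with inl i => B1 i | inr j => B2 j end); split.
- by move=> k; case: (fintype.split k).
- by move=> k; case: (fintype.split k).
apply/seteqP; split => w.
  by move=> [w1 w2] k _ /=; case: (fintype.split k) => i; [exact: w1|exact: w2].
move=> ww; split=> i _ /=.
  by have := ww (unsplit (inl i)) I; rewrite unsplitK.
by have := ww (unsplit (inr i)) I; rewrite unsplitK.
Qed.

Lemma rv_events_measurable F A : (forall X, F X -> measurable_fun setT X) ->
  rv_events F A -> measurable A.
Proof.
move=> mF [n [X [B [FX mB ->]]]].
apply: fin_bigcap_measurable; first exact: finite_finset.
by move=> k _; rewrite -[X in measurable X]setTI; exact: mF.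
Qed.

Variables (I : eqType) (F : I -> set (Omega -> R)).

(** A pi-system generating the sigma-algebra of all sources with label in [D]. Only finitely many
    labels occur in each event, so that [mindep] applies to it directly. *)
Definition pi_events (D : pred I) : set (set Omega) :=
  [set A | exists (J : seq I) (A' : I -> set Omega),
     [/\ uniq J, all D J, (forall j, j \in J -> rv_events (F j) (A' j)) &
         A = \bigcap_(j in [set` J]) A' j]].

Lemma pi_eventsT D : pi_events D setT.
Proof.
exists [::], (fun=> setT); split => //.
by rewrite bigcapT.
Qed.

Lemma pi_eventsI D : setI_closed (pi_events D).
Proof.
move=> _ _ [J1 [A1 [u1 D1 F1 ->]]] [J2 [A2 [u2 D2 F2 ->]]].
(* A label missing from one of the two lists is padded with the sure event. *)
exists (undup (J1 ++ J2)), (fun j => (if j \in J1 then A1 j else setT) `&`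
  (if j \in J2 then A2 j else setT)); split.
- exact: undup_uniq.
- by apply/allP => j; rewrite mem_undup mem_cat => /orP[/(allP D1)|/(allP D2)].
- move=> j _; apply: rv_eventsI; case: ifPn => jJ //;
    by [exact: F1|exact: F2|exact: rv_eventsT].
apply/seteqP; split => w.
  by move=> [w1 w2] j _; split; case: ifPn => // jJ; [exact: w1|exact: w2].
move=> ww; split => j /= jJ; have /= := ww j;
  by rewrite mem_undup mem_cat jJ ?orbT => -[].
Qed.

Lemma pi_events_rv (D : pred I) j X (B : set R) : D j -> F j X -> measurable B ->
  pi_events D (X @^-1` B).
Proof.
move=> Dj FX mB; exists [:: j], (fun=> X @^-1` B); split => //=; first by rewrite Dj.
  by move=> i; rewrite inE => /eqP ->; exact: rv_events_preimage.
by rewrite set_cons1 bigcap_set1.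
Qed.

Hypothesis mF : forall j X, F j X -> measurable_fun setT X.

Lemma pi_events_measurable D : pi_events D `<=` measurable.
Proof.
move=> _ [J [A [_ _ FA ->]]]; apply: fin_bigcap_measurable.
  exact: finite_seq.
by move=> j /= jJ; apply: rv_events_measurable (FA j jJ) => X; exact: mF.
Qed.

Lemma pi_events_measurable_fun (D : pred I) j X : D j -> F j X ->
  @measurable_fun _ _ (sigma_type (pi_events D)) R setT X.
Proof.
move=> Dj FX _ B mB; rewrite setTI; apply: sub_sigma_algebra.
exact: pi_events_rv FX mB.
Qed.

Hypothesis indepF : mindep P F.

(** Disjointness of [D1] and [D2] keeps the concatenated label list duplicate-free, so [mindep]
    applies to it as well as to each half. *)
Lemma pi_events_indep (D1 D2 : pred I) A B : [predI D1 & D2] =1 pred0 ->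
  pi_events D1 A -> pi_events D2 B -> P (A `&` B) = (P A * P B)%E.
Proof.
move=> D12 [J1 [A1 [u1 D1J F1 ->]]] [J2 [A2 [u2 D2J F2 ->]]].
have J12 j : j \in J2 -> j \notin J1.
  move=> jJ2; apply/negP => jJ1; have /negbT/negP := D12 j; apply.
  by apply/andP; split; [exact: (allP D1J)|exact: (allP D2J)].
pose A' j := if j \in J1 then A1 j else A2 j.
have -> : \bigcap_(j in [set` J1]) A1 j `&` \bigcap_(j in [set` J2]) A2 j =
    \bigcap_(j in [set` J1 ++ J2]) A' j.
  apply/seteqP; split => w.
    move=> [w1 w2] j /=; rewrite mem_cat /A'.
    by case: ifPn => [j1 _|_ /= j2]; [exact: w1|exact: w2].
  move=> ww; split=> j /= jJ; have /= := ww j;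
    rewrite mem_cat jJ ?orbT /A' ?jJ; first exact.
  by rewrite (negbTE (J12 _ jJ)); exact.
rewrite indepF.
- rewrite big_cat/= (indepF u1 F1) (indepF u2 F2); congr (_ * _)%E.
    by rewrite big_seq [RHS]big_seq; apply: eq_bigr => j jJ; rewrite /A' jJ.
  rewrite big_seq [RHS]big_seq; apply: eq_bigr => j jJ.
  by rewrite /A' (negbTE (J12 _ jJ)).
- rewrite cat_uniq u1 u2 andbT/=; apply/hasPn => j; exact: J12.
- move=> j; rewrite mem_cat /A'; case: ifPn => [j1 _|_ /= j2]; first exact: F1.
  exact: F2.
Qed.

End independence.

Section decoupling.
Context {R : realType} {d0 : measure_display} {Omega : measurableType d0}.
Variable P : probability Omega R.
Variables C1 C2 : set (set Omega).
Hypotheses (C1I : setI_closed C1) (C2I : setI_closed C2).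
Hypotheses (C1T : C1 setT) (C2T : C2 setT).
Hypotheses (mC1 : C1 `<=` measurable) (mC2 : C2 `<=` measurable).
Hypothesis C12 : forall A B, C1 A -> C2 B -> P (A `&` B) = (P A * P B)%E.

Let sub_measurable (C : set (set Omega)) :
  C `<=` measurable -> <<s C >> `<=` measurable.
Proof.
by move=> mC; apply: smallest_sub => //; exact: sigma_algebra_measurable.
Qed.

(** Uniqueness of finite measures: A -> P(A & B) and A -> P(A) P(B) agree on the pi-system [C],
    hence on the sigma-algebra it generates. Applied once in each argument, it lifts independence
    from generators to sigma-algebras. *)
Let half (C : set (set Omega)) B : setI_closed C -> C setT -> C `<=` measurable ->
  measurable B ->
  (forall A, C A -> P (A `&` B) = (P A * P B)%E) ->
  forall A, <<s C >> A -> P (A `&` B) = (P A * P B)%E.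
Proof.
move=> CI CT mC mB CB A sA.
have fB : (0 <= fine (P B))%R by rewrite fine_ge0.
have HT : C = [set X | C X /\ X `<=` setT].
  by apply/seteqP; split => [X|X []].
have := @g_sigma_algebra_measure_unique_trace _ R Omega C setT measurableT.
rewrite -HT => /(_ mC CI (mrestr P mB) (mscale (NngNum fB) P)).
have E X : C X -> mrestr P mB X = mscale (NngNum fB) P X.
  move=> CX; rewrite /mrestr /mscale/= CB// muleC fineK//.
  by rewrite fin_num_measure.
move=> /(_ (E _ CT) E); rewrite -ge0_fin_numE ?measure_ge0//.
rewrite fin_num_measure//.
move=> /(_ isT) /(_ (fun X _ => subsetT X)) /(_ _ sA).
move=> PAB; rewrite -[LHS]/(mrestr P mB A) [LHS]PAB.
by rewrite -[LHS]/((fine (P B))%:E * P A)%E fineK ?fin_num_measure// muleC.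
Qed.

Lemma g_sigma_algebra_indep A B : <<s C1 >> A -> <<s C2 >> B ->
  P (A `&` B) = (P A * P B)%E.
Proof.
move=> sA sB; apply: (@half C1) => //; first exact: sub_measurable sB.
move=> {sA} A' C1A'; rewrite setIC muleC; apply: (@half C2) => //.
  exact: mC1.
by move=> B' C2B'; rewrite setIC muleC; exact: C12.
Qed.

(** Take two copies of [Omega], carrying the coarser sigma-algebras generated by [C1] and [C2].
    Independence says that the image of [P] under the diagonal w -> (w, w) is the product of its
    marginals; Tonelli then gives the iterated integral. This plays the role of conditioning on the
    first sigma-algebra. *)
Lemma decoupling
    (f : (sigma_type C1 * sigma_type C2)%type -> \bar R) :
  measurable_fun setT f -> (forall z, 0 <= f z)%E ->
  (\int[P]_w f (w, w) = \int[P]_w \int[P]_w' f (w, w'))%E.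
Proof.
move=> mf f0.
have m1 : measurable_fun setT (id : Omega -> sigma_type C1).
  by move=> _ B mB; rewrite setTI; exact: sub_measurable mB.
have m2 : measurable_fun setT (id : Omega -> sigma_type C2).
  by move=> _ B mB; rewrite setTI; exact: sub_measurable mB.
pose i1 : {mfun Omega >-> sigma_type C1} :=
  HB.pack (id : Omega -> sigma_type C1)
    (isMeasurableFun.Build _ _ _ _ _ m1).
pose i2 : {mfun Omega >-> sigma_type C2} :=
  HB.pack (id : Omega -> sigma_type C2)
    (isMeasurableFun.Build _ _ _ _ _ m2).
have mdg : @measurable_fun _ _ Omega (sigma_type C1 * sigma_type C2)%type setT (fun w => (w, w)).
  exact: (measurable_fun_pair m1 m2).
pose dg : {mfun Omega >-> (sigma_type C1 * sigma_type C2)%type} :=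
  HB.pack (fun w : Omega => (w, w) : (sigma_type C1 * sigma_type C2)%type)
    (isMeasurableFun.Build _ _ _ _ _ mdg).
have -> : (\int[P]_w f (w, w) = \int[distribution P dg]_z f z)%E.
  by rewrite ge0_integral_distribution.
have Edg X : measurable X ->
    (distribution P i1 \x distribution P i2)%E X = distribution P dg X.
  apply: product_measure_unique => A B mA mB.
  by rewrite /distribution /pushforward/= -g_sigma_algebra_indep.
rewrite (eq_measure_integral (distribution P i1 \x distribution P i2)%E); last first.
  by move=> A mA _; rewrite /= Edg.
rewrite fubini_tonelli1// /fubini_F/=.
rewrite ge0_integral_distribution//; last 2 first.
- exact: measurable_fun_fubini_tonelli_F.
- by move=> y; exact: integral_ge0.
apply: eq_integral => w _ /=; rewrite ge0_integral_distribution//.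
exact: measurableT_comp.
Qed.

End decoupling.

Lemma mindep_decoupling {R : realType} {d0 : measure_display}
    {Omega : measurableType d0} (P : probability Omega R) (I : eqType)
    (F : I -> set (Omega -> R)) (D1 D2 : pred I) :
  (forall j X, F j X -> measurable_fun setT X) -> mindep P F ->
  [predI D1 & D2] =1 pred0 ->
  forall f : (sigma_type (pi_events F D1) * sigma_type (pi_events F D2))%type -> \bar R,
    measurable_fun setT f -> (forall z, 0 <= f z)%E ->
  (\int[P]_w f (w, w) = \int[P]_w \int[P]_w' f (w, w'))%E.
Proof.
move=> mF indepF D12; apply: decoupling.
- exact: pi_eventsI.
- exact: pi_eventsI.
- exact: pi_eventsT.
- exact: pi_eventsT.
- exact: pi_events_measurable.
- exact: pi_events_measurable.
- by move=> A B; exact: pi_events_indep.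
Qed.

(** * Right-continuous processes at random times *)

Section eval.
Context {R : realType} {dE : measure_display} {E : measurableType dE}.

(** The random time is approximated from above on the grid of step 1/(n+1). On the grid the process
    takes countably many measurable pieces, and right-continuity passes to the limit. Adding 1 to
    the truncated index keeps the grid point strictly above [a e], as a right limit demands. *)
Lemma measurable_fun_eval (X : R -> E -> R) (a : E -> R) :
  (forall t, 0 <= t -> measurable_fun setT (X t)) ->
  (forall e t, 0 <= t -> X t' e @[t' --> t^'+] --> X t e) ->
  measurable_fun setT a -> (forall e, 0 <= a e) ->
  measurable_fun setT (fun e => X (a e) e).
Proof.
move=> mX rcX ma a0.
pose k n e := Num.truncn (a e * n.+1%:R).
pose u n e : R := (k n e).+1%:R / n.+1%:R.
have kP n e : (k n e)%:R <= a e * n.+1%:R < (k n e).+1%:R.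
  by apply: truncn_itv; rewrite mulr_ge0.
have uP n e : a e < u n e <= a e + n.+1%:R^-1.
  have /andP[k1 k2] := kP n e.
  rewrite /u ltr_pdivlMr// k2/= ler_pdivrMr// mulrDl mulVf// -natr1.
  by rewrite lerD2r.
apply: (@measurable_fun_cvg _ _ _ _ (fun n e => X (u n e) e)) => [n|e _].
  move=> _ B mB; rewrite setTI.
  have -> : (fun e => X (u n e) e) @^-1` B =
      \bigcup_i ((fun e => a e * n.+1%:R) @^-1` [set` `[i%:R, i.+1%:R[] `&`
        X (i.+1%:R / n.+1%:R) @^-1` B).
    apply/seteqP; split => e /=.
      by move=> XB; exists (k n e) => //; split; [rewrite /= in_itv/= kP|exact: XB].
    move=> [i _ /= []]; rewrite in_itv/= => aeE.
    suff -> : i = k n e by [].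
    apply/esym/eqP; rewrite /k truncn_eq//.
    by rewrite mulr_ge0.
  apply: bigcupT_measurable => i; apply: measurableI.
    rewrite -[X in measurable X]setTI.
    have mam : measurable_fun setT (fun e => a e * n.+1%:R).
      by apply: measurable_funM => //; exact: measurable_cst.
    exact: mam.
  by rewrite -[X in measurable X]setTI; apply: mX.
have [+ _] := @cvg_at_rightP R (X^~ e) (a e) (X (a e) e).
apply; first exact: rcX.
split; first by move=> n; have /andP[] := uP n e.
apply: (@squeeze_cvgr _ _ _ _ (fun=> a e) (fun n => a e + n.+1%:R^-1)).
- by apply: nearW => n; have /andP[/ltW -> ->] := uP n e.
- exact: cvg_cst.
rewrite -[X in _ --> X]addr0; apply: cvgD; first exact: cvg_cst.
exact: cvg_harmonic.
Qed.

End eval.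

Lemma within_continuous_right {R : realType} (f : R -> R) :
  {within [set` `[0, +oo[%R], continuous f} ->
  forall t, 0 <= t -> f t' @[t' --> t^'+] --> f t.
Proof.
move=> /continuous_within_itvcyP[cf f0] t.
rewrite le_eqVlt => /orP[/eqP <- //|t0].
apply: cvg_at_right_filter; apply: cf.
by rewrite in_itv/= t0.
Qed.

(** * Integrals without measurability, densities, Gaussian moments *)

Section integral_facts.
Local Open Scope ereal_scope.
Context {d : measure_display} {T : measurableType d} {R : realType}.
Implicit Type mu : {measure set T -> \bar R}.

(* No measurability: the integral of a nonnegative function is a supremum over
   the simple functions below it. *)
Lemma le_integral_nonmeasurable mu (D : set T) (f g : T -> \bar R) :
  (forall x, D x -> 0 <= f x) -> (forall x, D x -> f x <= g x) ->
  \int[mu]_(x in D) f x <= \int[mu]_(x in D) g x.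
Proof.
move=> f0 fg; have g0 x : D x -> 0 <= g x.
  by move=> Dx; rewrite (le_trans (f0 _ Dx))// fg.
rewrite !ge0_integralE//; apply: ereal_sup_le => _ [h hf <-].
exists h => // x; rewrite (le_trans (hf x))// /patch.
by case: ifPn => // /set_mem; exact: fg.
Qed.

Import HBNNSimple.

(** Laws are given in this setting by the probabilities of events only. The passage to integrals
    goes through indicators, simple functions and monotone limits. *)
Lemma ge0_integral_density mu (nu : {measure set T -> \bar R}) (f : T -> R)
    (h : T -> \bar R) :
  measurable_fun setT f -> (forall x, 0 <= f x)%R ->
  (forall A, measurable A -> nu A = \int[mu]_(x in A) (f x)%:E) ->
  measurable_fun setT h -> (forall x, 0 <= h x) ->
  \int[nu]_x h x = \int[mu]_x (h x * (f x)%:E).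
Proof.
move=> mf f0 nuE mh h0; pose g := nnsfun_approx measurableT mh.
have mfE : measurable_fun setT (fun x => (f x)%:E) by exact/measurable_EFinP.
(* The identity is wanted for values [r] of [g n] only, since these are known to be nonnegative. *)
have indicE r n : \int[nu]_x ((r * \1_(g n @^-1` [set r]) x)%R)%:E =
    \int[mu]_x ((r * \1_(g n @^-1` [set r]) x)%:E * (f x)%:E) \/ ~ range (g n) r.
  have [rg|?] := pselect (range (g n) r); [left|by right].
  have r0 : (0 <= r)%R by case: rg => x _ <-.
  under eq_integral do rewrite EFinM.
  rewrite integralZl_indic_nnsfun// integral_indic// setIT nuE//.
  under [RHS]eq_integral do rewrite EFinM -muleA.
  rewrite ge0_integralZl//.
  - under [in RHS]eq_integral do rewrite muleC.
    rewrite [in RHS](eq_integral ((fun x => (f x)%:E) \_ (g n @^-1` [set r]))); last first.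
      by move=> x xE; rewrite epatch_indic.
    by rewrite -integral_mkcondr setTI.
  - by apply: emeasurable_funM => //; exact/measurable_EFinP.
  - by move=> x _; rewrite mule_ge0// lee_fin.
have step n : \int[nu]_x (EFin \o g n) x = \int[mu]_x ((EFin \o g n) x * (f x)%:E).
  transitivity (\int[nu]_x
     (\sum_(y \in range (g n)) (y * \1_(g n @^-1` [set y]) x)%:E)).
    by apply: eq_integral => t tE; rewrite /= fimfunE -fsumEFin.
  have mind r : measurable_fun setT (fun x => (r * \1_(g n @^-1` [set r]) x)%:E).
    by apply/measurable_EFinP; exact: measurable_funM.
  rewrite ge0_integral_fsum//; last by move=> m y Ey; exact: nnfun_muleindic_ge0.
  transitivity (\int[mu]_x (\sum_(y \in range (g n))
      (y * \1_(g n @^-1` [set y]) x)%:E * (f x)%:E)); last first.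
    apply: eq_integral => x xE.
    rewrite -ge0_mule_fsuml => [|y]; last exact: nnfun_muleindic_ge0.
    by rewrite fsumEFin // -(fimfunE _ x).
  rewrite ge0_integral_fsum//; last 2 first.
    - by move=> y; exact: emeasurable_funM.
    - by move=> m y Ey; apply: mule_ge0; [exact: nnfun_muleindic_ge0|rewrite lee_fin].
  apply: eq_fsbigr => r; rewrite inE => rg.
  by case: (indicE r n).
have -> : \int[nu]_x h x = limn (fun n => \int[nu]_x (EFin \o g n) x).
  have hE x : h x = limn (fun n => (EFin \o g n) x).
    by apply/esym/cvg_lim => //; exact: cvg_nnsfun_approx.
  under eq_integral do rewrite hE.
  apply: monotone_convergence => //.
  - by move=> n; exact/measurable_EFinP.
  - by move=> n x _ /=; rewrite lee_fin.
  - by move=> x _ a b ab; rewrite lee_fin; exact/lefP/nd_nnsfun_approx.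
have -> : \int[mu]_x (h x * (f x)%:E) =
    limn (fun n => \int[mu]_x ((EFin \o g n) x * (f x)%:E)).
  have hE x : h x * (f x)%:E = limn (fun n => (EFin \o g n) x * (f x)%:E).
    apply/esym/cvg_lim => //; apply: cvgeZr => //.
    exact: cvg_nnsfun_approx.
  under eq_integral do rewrite hE.
  apply: monotone_convergence => //.
  - by move=> n; apply: emeasurable_funM => //; exact/measurable_EFinP.
  - by move=> n x _ /=; rewrite mule_ge0 ?lee_fin.
  - move=> x _ a b ab /=; rewrite lee_wpmul2r ?lee_fin//.
    exact/lefP/nd_nnsfun_approx.
by under eq_fun do rewrite step.
Qed.

End integral_facts.

Lemma ge0_integral_law {R : realType} {d0 : measure_display}
    {Omega : measurableType d0} (P : probability Omega R) (X : Omega -> R)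
    (f : R -> R)
    (h : R -> \bar R) :
  measurable_fun setT X -> measurable_fun setT f -> (forall x, 0 <= f x) ->
  (forall A, measurable A ->
     P (X @^-1` A) = \int[@lebesgue_measure R]_(x in A) (f x)%:E)%E ->
  measurable_fun setT h -> (forall x, 0 <= h x)%E ->
  (\int[P]_w h (X w) = \int[@lebesgue_measure R]_x (h x * (f x)%:E))%E.
Proof.
move=> mX mf f0 PX mh h0.
have mX' : @measurable_fun _ _ Omega (measurableTypeR R) setT X by exact: mX.
pose X' : {mfun Omega >-> measurableTypeR R} :=
  HB.pack (X : Omega -> measurableTypeR R) (isMeasurableFun.Build _ _ _ _ _ mX').
rewrite -(@ge0_integral_density _ (measurableTypeR R) _ (@lebesgue_measure R)
  (distribution P X') f h)//.
by rewrite ge0_integral_distribution.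
Qed.

(** * Gaussian moments, and negative powers as Laplace integrals *)

Section analytic.
Context {R : realType}.
Implicit Types a b p v x y z : R.

Lemma powR_le_expR b : 0 <= b ->
  exists2 C, 0 < C & forall z, 0 <= z -> powR z b <= C * expR z.
Proof.
move=> b0; pose n := Num.truncn b.
(* For z > 1, z^b <= z^(n+1) <= (n+1)! e^z by the exponential series; the summand 1 covers z <=
   1. *)
exists (1 + n.+1`!%:R); first by rewrite addr_gt0.
move=> z z0; have ez1 : 1 <= expR z by rewrite -expR0 ler_expR.
have [z1|z1] := leP z 1.
  rewrite (@le_trans _ _ 1)//.
    have -> : 1 = powR 1 b :> R by rewrite powR1.
    by rewrite ge0_ler_powR ?nnegrE.
  by rewrite mulrDl mul1r (le_trans ez1)// lerDl mulr_ge0// expR_ge0.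
rewrite (@le_trans _ _ (z ^+ n.+1))//.
  rewrite -powR_mulrn// ler_powR ?(ltW z1)//.
  by have /andP[_ /ltW] := truncn_itv b0.
have := expR_ge1Dxn n z0; rewrite addrC -lerBrDr ler_pdivrMr//.
move/le_trans; apply.
have : 0 <= n.+1`!%:R :> R by [].
nra.
Qed.
End analytic.

Section analytic2.
Context {R : realType}.
Implicit Types a b p v x y z : R.

Lemma gauss_pdf_ge0 v y : 0 <= gauss_pdf v y.
Proof. by rewrite mulr_ge0 ?invr_ge0 ?sqrtr_ge0 ?expR_ge0. Qed.

Lemma gauss_pdfE v y : 0 < v -> gauss_pdf v y = normal_pdf 0 (Num.sqrt v) y.
Proof.
move=> v0; rewrite /normal_pdf gt_eqF ?sqrtr_gt0//.
rewrite /normal_peak /normal_fun /gauss_pdf sqr_sqrtr ?(ltW v0)// subr0.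
have E : v * pi *+ 2 = 2 * pi * v :> R by rewrite -mulr_natl; ring.
by rewrite E -(mulr_natl v).
Qed.

Lemma measurable_gauss_pdf v : 0 < v -> measurable_fun setT (gauss_pdf v).
Proof.
move=> v0; rewrite (_ : gauss_pdf v = normal_pdf 0 (Num.sqrt v)); last first.
  by apply/funext => y; exact: gauss_pdfE.
exact: measurable_normal_pdf.
Qed.

(** Half of the Gaussian exponent is spent on absorbing the power. With z = y^2/(4v) the exponential
    is e^(-2z); one e^(-z) dominates z^(a/2), and the other is the exponential of the density of
    variance 2v, whose total mass is 1. *)
Lemma abs_gauss_pdf_le a : 0 <= a -> exists2 C, 0 < C &
  forall v y, 0 < v ->
    powR `|y| a * gauss_pdf v y <= C * powR v (a / 2) * gauss_pdf (2 * v) y.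
Proof.
move=> a0; have a20 : 0 <= a / 2 by rewrite divr_ge0.
have [C C0 HC] := powR_le_expR a20.
exists (powR 4 (a / 2) * C * Num.sqrt 2) => [|v y v0].
  by rewrite !mulr_gt0// ?powR_gt0// sqrtr_gt0.
pose z := y ^+ 2 / (4 * v).
have z0 : 0 <= z by rewrite divr_ge0 ?sqr_ge0// mulr_ge0// ltW.
have ya : powR `|y| a = powR 4 (a / 2) * powR v (a / 2) * powR z (a / 2).
  have v40 : 0 <= 4 * v by rewrite mulr_ge0 ?ltW.
  rewrite -(powRM _ (ler0n R 4) (ltW v0)) -(powRM _ v40 z0).
  have -> : 4 * v * z = `|y| ^+ 2.
    by rewrite /z real_normK ?num_real//; field; rewrite gt_eqF.
  by rewrite -powR_mulrn// -powRrM; congr (powR _ _); field.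
have gE : gauss_pdf v y =
    Num.sqrt 2 * (expR (- z) * gauss_pdf (2 * v) y).
  have E1 : Num.sqrt (2 * pi * (2 * v)) = Num.sqrt 2 * Num.sqrt (2 * pi * v).
    by rewrite -sqrtrM//; congr Num.sqrt; ring.
  have E2 : - (y ^+ 2) / (2 * (2 * v)) = - z by rewrite /z; field; rewrite gt_eqF.
  have E3 : - (y ^+ 2) / (2 * v) = - z + - z by rewrite /z; field; rewrite gt_eqF.
  rewrite /gauss_pdf E1 E2 E3 expRD; field.
  by rewrite !gt_eqF// sqrtr_gt0// !mulr_gt0// pi_gt0.
have g0 := gauss_pdf_ge0 (2 * v) y.
rewrite ya gE.
have ezC : powR z (a / 2) * expR (- z) <= C.
  by rewrite expRN ler_pdivrMr ?expR_gt0// HC.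
rewrite [leLHS](_ : _ = (powR 4 (a / 2) * powR v (a / 2) * Num.sqrt 2 *
   gauss_pdf (2 * v) y) * (powR z (a / 2) * expR (- z))); last by ring.
rewrite [leRHS](_ : _ = (powR 4 (a / 2) * powR v (a / 2) * Num.sqrt 2 *
   gauss_pdf (2 * v) y) * C); last by ring.
by rewrite ler_wpM2l// !mulr_ge0// ?powR_ge0// sqrtr_ge0.
Qed.

(** The constant is chosen before the probability space and the variable, because T will depend on
    it. *)
Lemma gaussian_abs_moment a : 0 <= a -> exists2 C, 0 < C &
  forall (d0 : measure_display) (Omega : measurableType d0)
    (P : probability Omega R) (X : Omega -> R) v, 0 < v ->
    measurable_fun setT X -> gaussian_law P X v ->
    (\int[P]_w (powR `|X w| a)%:E <= (C * powR v (a / 2))%:E)%E.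
Proof.
move=> a0; have [C C0 HC] := abs_gauss_pdf_le a0.
exists C => // d0 Omega P X v v0 mX lawX.
have mp : measurable_fun setT (fun y : R => powR `|y| a).
  exact: (measurableT_comp (measurable_powR a) (@normr_measurable R setT)).
rewrite (@ge0_integral_law _ _ _ P X (gauss_pdf v) (fun y => (powR `|y| a)%:E))//; last 3 first.
- exact: measurable_gauss_pdf.
- exact: gauss_pdf_ge0.
- exact/measurable_EFinP.
have v20 : 0 < 2 * v by rewrite mulr_gt0.
apply: (@le_trans _ _ (\int[@lebesgue_measure R]_x
    ((C * powR v (a / 2))%:E * (gauss_pdf (2 * v) x)%:E))%E).
  apply: le_integral_nonmeasurable => x _.
    by rewrite -EFinM lee_fin mulr_ge0 ?powR_ge0 ?gauss_pdf_ge0.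
  by rewrite -!EFinM lee_fin HC.
rewrite ge0_integralZl_EFin//.
- under eq_integral do rewrite gauss_pdfE//.
  by rewrite integral_normal_pdf mule1 lexx.
- by move=> x _; rewrite lee_fin gauss_pdf_ge0.
- by apply/measurable_EFinP; exact: measurable_gauss_pdf.
- by rewrite mulr_ge0 ?powR_ge0// ltW.
Qed.

(* On [1/(2v), 1/v] the integrand is at least e^-1 2^-|p/2-1| v^(1-p/2). *)
Lemma powR_le_laplace p : 0 < p -> exists2 C, 0 < C & forall v, 0 < v ->
  (((powR v (p / 2))^-1)%:E <= C%:E * \int[@lebesgue_measure R]_(lam in [set` `]0%R, +oo[%R])
     (expR (- (lam * v)) * powR lam (p / 2 - 1))%:E)%E.
Proof.
move=> p0; set q := p / 2 - 1.
pose k := powR 2^-1 `|q| : R; have k0 : 0 < k by rewrite powR_gt0.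
have e0 : 0 < expR 1 :> R by exact: expR_gt0.
exists (2 * expR 1 / k) => [|v v0]; first by rewrite divr_gt0// mulr_gt0.
have v20 : 0 < (2 * v)^-1 by rewrite invr_gt0 mulr_gt0.
have vv : (2 * v)^-1 < v^-1 by rewrite ltf_pV2 ?posrE ?mulr_gt0// ltr_pMl// ltr1n.
pose m := expR (- 1) * (k * powR v^-1 q).
have m0 : 0 <= m by rewrite !mulr_ge0 ?expR_ge0 ?powR_ge0.
have : (\int[@lebesgue_measure R]_(lam in [set` `](2 * v)^-1, v^-1[%R]) m%:E <=
    \int[@lebesgue_measure R]_(lam in [set` `]0%R, +oo[%R])
     (expR (- (lam * v)) * powR lam q)%:E)%E.
  rewrite integral_mkcond [leRHS]integral_mkcond.
  apply: le_integral_nonmeasurable => lam _.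
    by rewrite /patch; case: ifPn => // _; rewrite lee_fin.
  rewrite /patch; case: ifPn => [|_]; last first.
    by case: ifPn => // _; rewrite lee_fin mulr_ge0 ?expR_ge0 ?powR_ge0.
  rewrite inE/= in_itv/= => /andP[l1 l2].
  have l0 : 0 < lam by rewrite (lt_trans _ l1).
  rewrite ifT; last by rewrite inE/= in_itv/= l0.
  have lv1 : lam * v <= 1 by rewrite -ler_pdivlMr// mul1r ltW.
  have lv2 : 2^-1 <= lam * v.
    by rewrite -ler_pdivrMr// -invfM ltW.
  have lv0 : 0 < lam * v by rewrite mulr_gt0.
  rewrite lee_fin /m ler_pM ?expR_ge0 ?mulr_ge0 ?powR_ge0//.
    by rewrite ler_expR lerN2.
  rewrite (_ : powR lam q = powR (lam * v) q * powR v^-1 q); last first.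
    by rewrite -powRM ?(ltW lv0) ?invr_ge0 ?(ltW v0)// mulfK ?gt_eqF.
  rewrite ler_wpM2r ?powR_ge0// /k.
  have [q0|q0] := leP 0 q.
    by rewrite ger0_norm// ge0_ler_powR ?nnegrE ?invr_ge0// ltW.
  rewrite (@le_trans _ _ 1)//.
    rewrite [leRHS](_ : 1 = powR 2^-1 0); last by rewrite powRr0.
    by apply: ger_powR => //; rewrite invr_gt0 ltr0n/= invf_le1// ler1n.
  rewrite [leLHS](_ : 1 = powR (lam * v) 0); last by rewrite powRr0.
  by apply: ger_powR; [rewrite lv0|exact: ltW].
rewrite integral_cst//= lebesgue_measure_itv/= lte_fin vv.
have C0 : (0 <= (2 * expR 1 / k)%:E)%E by rewrite lee_fin divr_ge0 ?mulr_ge0 ?ltW.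
move=> /(lee_wpmul2l C0); apply: le_trans.
rewrite -EFinB -!EFinM lee_fin le_eqVlt; apply/orP; left; apply/eqP.
rewrite /m expRN.
have -> : powR v (p / 2) = powR v q * v.
  rewrite -{3}(powRr1 (ltW v0)) -powRD ?(gt_eqF v0)/= ?implybT//.
  by rewrite /q subrK.
have -> : powR v^-1 q = (powR v q)^-1.
  by rewrite -powR_inv1 ?ltW// -powRrM mulN1r powRN.
have vq : powR v q != 0 by rewrite gt_eqF ?powR_gt0.
by field; rewrite vq !gt_eqF.
Qed.

End analytic2.

(** * The Laplace exponent *)

Section laplace.
Context {R : realType}.
Variables (eta : R -> R) (p : R).
Local Notation leb := (@lebesgue_measure R).
Local Notation pos := [set` `]0, +oo[%R].

(** Since E exp(-lam S_s) = exp(-s eta(lam)), this is Gamma(p/2) times E S_s^(-p/2) for p > 0, with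
    0^(-p/2) read as +oo. *)
Definition laplace_int (s : R) : \bar R :=
  (\int[leb]_(lam in pos) (expR (- (s * eta lam)) * powR lam (p / 2 - 1))%:E)%E.

Lemma laplace_int_ge0 s : (0 <= laplace_int s)%E.
Proof.
by apply: integral_ge0 => x _; rewrite lee_fin mulr_ge0 ?expR_ge0 ?powR_ge0.
Qed.

Hypothesis eta_bern : bernstein eta.

Lemma bernstein_measurable : measurable_fun (pos : set R) eta.
Proof.
apply: open_continuous_measurable_fun; first exact: interval_open.
move=> x; rewrite inE/= in_itv/= andbT => x0.
have [_ D _] := eta_bern; have /derivable1_diffP := D 0%N x x0.
exact: differentiable_continuous.
Qed.

(** A Bernstein function is controlled on the positive half-line only; extending it by 0 makes joint
    measurability on the whole plane available. *)
Let etap : R -> R := eta \_ (pos : set R).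

Let measurable_etap : measurable_fun setT etap.
Proof.
by apply/(measurable_restrictT _ _).1 => //; exact: bernstein_measurable.
Qed.

Definition laplace_integrand (z : R * measurableTypeR R) : \bar R :=
  (expR (- (z.1 * etap z.2)) * powR z.2 (p / 2 - 1) * \1_(pos : set R) z.2)%:E.

Lemma measurable_laplace_integrand : measurable_fun setT laplace_integrand.
Proof.
apply/measurable_EFinP; apply: measurable_funM; last first.
  exact: (measurableT_comp (measurable_indic (measurable_itv _)) measurable_snd).
apply: measurable_funM; last first.
  exact: (measurableT_comp (measurable_powR _) measurable_snd).
apply: measurableT_comp => //; apply: measurableT_comp => //.
apply: measurable_funM => //.
exact: (measurableT_comp measurable_etap measurable_snd).
Qed.

Lemma laplace_intE s : laplace_int s = fubini_F leb laplace_integrand s.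
Proof.
rewrite /laplace_int /fubini_F [LHS]integral_mkcond; apply: eq_integral => x _.
rewrite /patch /laplace_integrand /etap/= indicE.
by case: ifPn => xp; rewrite ?mulr0 ?mulr1// /patch xp.
Qed.

Lemma measurable_laplace_int : measurable_fun setT laplace_int.
Proof.
rewrite (_ : laplace_int = fubini_F leb laplace_integrand); last first.
  by apply/funext => s; exact: laplace_intE.
apply: measurable_fun_fubini_tonelli_F => [|[s l]].
  exact: measurable_laplace_integrand.
by rewrite lee_fin !mulr_ge0 ?expR_ge0 ?powR_ge0.
Qed.

End laplace.

(** The pointwise bound is integrated over [Omega] and Tonelli brings the expectation inside, where
    it becomes the Laplace transform of [V]. *)
Lemma neg_moment_laplace {R : realType} (d0 : measure_display)
    (Omega : measurableType d0) (P : probability Omega R) (V : Omega -> R) (p C : R) :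
  0 < p -> 0 <= C ->
  (forall v, 0 < v -> (((powR v (p / 2))^-1)%:E <=
     C%:E * \int[@lebesgue_measure R]_(lam in [set` `]0%R, +oo[%R])
     (expR (- (lam * v)) * powR lam (p / 2 - 1))%:E)%E) ->
  measurable_fun setT V -> (forall w, 0 <= V w) ->
  (\int[P]_w ((powR (V w) (p / 2))^-1)%:E <=
   C%:E * \int[@lebesgue_measure R]_(lam in [set` `]0%R, +oo[%R])
     ((\int[P]_w (expR (- (lam * V w)))%:E) * (powR lam (p / 2 - 1))%:E))%E.
Proof.
move=> p0 C0 HC mV V0.
pose f (z : Omega * measurableTypeR R) : \bar R :=
  (expR (- (z.2 * V z.1)) * (powR z.2 (p / 2 - 1) *
    \1_([set` `]0%R, +oo[%R] : set R) z.2))%:E.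
have f0 z : (0 <= f z)%E by rewrite lee_fin !mulr_ge0 ?expR_ge0 ?powR_ge0.
have mf : measurable_fun setT f.
  apply/measurable_EFinP; apply: measurable_funM; last first.
    apply: measurable_funM.
      exact: (measurableT_comp (measurable_powR _) measurable_snd).
    exact: (measurableT_comp (measurable_indic (measurable_itv _)) measurable_snd).
  apply: measurableT_comp => //; apply: measurableT_comp => //.
  apply: measurable_funM => //.
  exact: (measurableT_comp mV measurable_fst).
have mF := measurable_fun_fubini_tonelli_F (m2 := @lebesgue_measure R) f mf f0.
have F0 w : (0 <= fubini_F (@lebesgue_measure R) f w)%E by exact: integral_ge0.
apply: (@le_trans _ _ (\int[P]_w (C%:E * fubini_F (@lebesgue_measure R) f w))%E).
  apply: le_integral_nonmeasurable => w _.
    by rewrite lee_fin invr_ge0 powR_ge0.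
  have := V0 w; rewrite le_eqVlt => /orP[/eqP <-|v0].
    (* On V = 0 the left-hand side is the inverse of 0, which is 0 by convention. *)
    rewrite powR0 ?invr0 ?mule_ge0 ?lee_fin//.
    by rewrite gt_eqF// divr_gt0.
  rewrite (le_trans (HC _ v0))// lee_wpmul2l ?lee_fin//.
  rewrite /fubini_F [leLHS]integral_mkcond le_eqVlt; apply/orP; left; apply/eqP.
  apply: eq_integral => x _; rewrite /patch /f/= indicE.
  by case: ifPn => xp; rewrite ?mulr0 ?mulr1.
rewrite ge0_integralZl_EFin// lee_wpmul2l ?lee_fin//.
rewrite /fubini_F fubini_tonelli// [leRHS]integral_mkcond.
apply: le_integral_nonmeasurable => l _.
  by apply: integral_ge0 => w _.
rewrite /patch /f/= indicE; case: ifPn => lp; last first.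
  by rewrite mulr0; under eq_integral do rewrite mulr0; rewrite integral0.
rewrite mulr1; under eq_integral do rewrite EFinM.
rewrite ge0_integralZr ?lee_fin ?powR_ge0//.
apply/measurable_EFinP; apply: measurableT_comp => //.
by apply: measurableT_comp => //; exact: measurable_funM.
Qed.

Lemma density_law_integral {R : realType} (d0 : measure_display)
    (Omega : measurableType d0) (P : probability Omega R) (tau : Omega -> R)
    (rho : R -> R) (h : R -> \bar R) :
  pos_density rho -> density_law P tau rho ->
  measurable_fun setT h -> (forall x, 0 <= h x)%E ->
  (\int[P]_w h (tau w) =
   \int[@lebesgue_measure R]_(s in [set` `[0%R, +oo[%R]) (h s * (rho s)%:E))%E.
Proof.
move=> [mrho rho0 _] [mtau tauP] mh h0.
pose f := rho \_ ([set` `[0%R, +oo[%R] : set R).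
have mf : measurable_fun setT f.
  apply/(measurable_restrictT _ _).1 => //; exact: measurable_funS mrho.
have f0 x : 0 <= f x.
  rewrite /f /patch; case: ifPn => //; rewrite inE/= in_itv/= andbT => x0.
  exact/ltW/rho0.
rewrite (@ge0_integral_law _ _ _ P tau f)//.
  rewrite [RHS]integral_mkcond; apply: eq_integral => x _.
  by rewrite /f /patch; case: ifPn => // _; rewrite mule0.
move=> A mA; rewrite tauP// integral_mkcondr; apply: eq_integral => x _.
by rewrite /f /patch; case: ifPn.
Qed.

(** * The random inputs of one particle *)

Section particles.
Context {R : realType} {d m : nat} {d0 : measure_display} {Omega : measurableType d0}.
Variable P : probability Omega R.
Variables (tau : seq nat -> Omega -> R) (Ix : seq nat -> Omega -> {ffun 'I_m.+1 -> nat})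
  (S : seq nat -> R -> Omega -> R) (B : seq nat -> R -> Omega -> 'rV[R]_d).

Definition sources (uk : seq nat * 'I_4) : set (Omega -> R) :=
  match val uk.2 with
  | 0 => [set tau uk.1]
  | 1 => [set X | exists r : 'I_m.+1, X = (fun w => ((Ix uk.1 w r)%:R : R))]
  | 2 => [set X | exists t, 0 <= t /\ X = S uk.1 t]
  | _ => [set X | exists t (j : 'I_d), 0 <= t /\ X = (fun w => B uk.1 t w 0 j)]
  end.

Definition src_tau (u : seq nat) : seq nat * 'I_4 := (u, @Ordinal 4 0 isT).
Definition src_idx (u : seq nat) : seq nat * 'I_4 := (u, @Ordinal 4 1 isT).
Definition src_sub (u : seq nat) : seq nat * 'I_4 := (u, @Ordinal 4 2 isT).
Definition src_bm (u : seq nat) : seq nat * 'I_4 := (u, @Ordinal 4 3 isT).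

Variables (eta : R -> R) (L : seq {ffun 'I_m.+1 -> nat})
  (q : {ffun 'I_m.+1 -> nat} -> R) (rho : R -> R).
Hypothesis pf : particle_family eta L q rho P tau Ix S B.

Let tau_law u : density_law P (tau u) rho.
Proof. by case: pf. Qed.

Lemma measurable_tau u : measurable_fun setT (tau u).
Proof. by case: (tau_law u). Qed.

Lemma measurable_Ix u (r : 'I_m.+1) : measurable_fun setT (fun w => ((Ix u w r)%:R : R)).
Proof. by case: pf. Qed.

Let sub_law u : subordinator P eta (S u).
Proof. by case: pf. Qed.

Let bm_law u : std_BM P (B u).
Proof. by case: pf => _ _ _ _ []. Qed.

Let sources_indep : mindep P sources.
Proof. by case: pf => _ _ _ _ []. Qed.

Lemma sources_measurable uk X : sources uk X -> measurable_fun setT X.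
Proof.
rewrite /sources; case: uk => u [[|[|[|[|//]]]] k]/=.
- by move=> ->; exact: measurable_tau.
- by move=> [r ->]; exact: measurable_Ix.
- by move=> [t [t0 ->]]; have [_ _ _ mS _] := sub_law u; exact: mS.
- by move=> [t [j [t0 ->]]]; have [_ _ mB _ _] := bm_law u; exact: mB.
Qed.

Lemma sub_ge0 u s w : 0 <= s -> 0 <= S u s w.
Proof.
move=> s0; have [S0 Smono _ _ _] := sub_law u.
by rewrite -(S0 w) Smono// lexx.
Qed.

Section evaluation.
Context {dE : measure_display} {E : measurableType dE}.
Variables (u : seq nat) (pi : E -> Omega).

Lemma measurable_sub_eval (a : E -> R) :
  (forall t, 0 <= t -> measurable_fun setT (S u t \o pi)) ->
  measurable_fun setT a -> (forall e, 0 <= a e) ->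
  measurable_fun setT (fun e => S u (a e) (pi e)).
Proof.
move=> mS; apply: (@measurable_fun_eval _ _ _ (fun t e => S u t (pi e))) => //.
by move=> e t t0; have [_ _ rc _ _] := sub_law u; exact: rc.
Qed.

Lemma measurable_bm_eval (j : 'I_d) (a : E -> R) :
  (forall t, 0 <= t -> measurable_fun setT (fun e => B u t (pi e) 0 j)) ->
  measurable_fun setT a -> (forall e, 0 <= a e) ->
  measurable_fun setT (fun e => B u (a e) (pi e) 0 j).
Proof.
move=> mB; apply: (@measurable_fun_eval _ _ _ (fun t e => B u t (pi e) 0 j)) => //.
move=> e t t0; have [_ cB _ _ _] := bm_law u.
exact: (within_continuous_right (cB (pi e) j)).
Qed.

End evaluation.

(** The clock [S] reads [w] and the path [B] reads [w'], so that the clock can be frozen while the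
    path is integrated out. The exponents (a, b) will be (p, p) at a branching and (2p, p) at a
    leaf. *)
Definition bm_ratio (a b : R) (u : seq nat) (j : 'I_d) (s : R) (w w' : Omega) : R :=
  powR `|B u (S u s w) w' 0 j| a / powR (S u s w) b.

Lemma bm_ratio_ge0 a b u j s w w' : 0 <= bm_ratio a b u j s w w'.
Proof. by rewrite divr_ge0 ?powR_ge0. Qed.

Lemma measurable_bm_ratio a b u j {dE : measure_display} {E : measurableType dE}
    (pi pi' : E -> Omega) (s : E -> R) :
  (forall t, 0 <= t -> measurable_fun setT (S u t \o pi)) ->
  (forall t, 0 <= t -> measurable_fun setT (fun e => B u t (pi' e) 0 j)) ->
  measurable_fun setT s -> (forall e, 0 <= s e) ->
  measurable_fun setT (fun e => bm_ratio a b u j (s e) (pi e) (pi' e)).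
Proof.
move=> mS mB ms s0.
have mSs := measurable_sub_eval mS ms s0.
apply: measurable_funM.
  apply: (measurableT_comp (measurable_powR a)).
  apply: measurableT_comp; first exact: normr_measurable.
  apply: (@measurable_bm_eval _ _ u pi') => // e; exact: sub_ge0.
rewrite (_ : (fun e => (powR (S u (s e) (pi e)) b)^-1) =
    (fun e => powR (S u (s e) (pi e)) (- b))).
  exact: (measurableT_comp (measurable_powR _) mSs).
by apply/funext => e; rewrite powRN.
Qed.

Lemma measurable_bm_ratioE a b u j s : 0 <= s ->
  measurable_fun setT (fun w => bm_ratio a b u j s w w).
Proof.
move=> s0; apply: (@measurable_bm_ratio _ _ _ _ _ _ id id) => //.
- by have [_ _ _ mS _] := sub_law u.
- by have [_ _ mB _ _] := bm_law u => t t0; exact: mB.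
Qed.

(* At S = 0 the ratio is 0 / 0 = 0, in agreement with B 0 = 0. *)
Lemma integral_bm_ratio a b C u j s : 0 < a -> 0 <= s ->
  (forall v X, 0 < v -> measurable_fun setT X -> gaussian_law P X v ->
    (\int[P]_w (powR `|X w| a)%:E <= (C * powR v (a / 2))%:E)%E) ->
  (\int[P]_w (bm_ratio a b u j s w w)%:E <=
   \int[P]_w (C * powR (S u s w) (a / 2) / powR (S u s w) b)%:E)%E.
Proof.
move=> a0 s0 HC.
have [B0 _ mB gB _] := bm_law u.
(* For a frozen clock value v > 0, the coordinate of B at time v is a centred Gaussian of variance
   v. *)
have /= -> := @mindep_decoupling _ _ _ P _ sources (pred1 (src_sub u))
    (pred1 (src_bm u)) sources_measurable sources_indep _
    (fun z => (bm_ratio a b u j s z.1 z.2)%:E); last 3 first.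
- by move=> x; apply/negbTE/negP => /andP[/eqP -> /eqP[]].
- apply/measurable_EFinP.
  apply: (@measurable_bm_ratio _ _ _ _ _ (sigma_type (pi_events sources (pred1 (src_sub u))) *
    sigma_type (pi_events sources (pred1 (src_bm u))))%type fst snd (fun=> s)) => //.
    move=> t t0; apply: (measurableT_comp _ measurable_fst).
    apply: (@pi_events_measurable_fun _ _ _ _ _ _ (src_sub u)); first exact: eqxx.
    by exists t.
  move=> t t0.
  have mb : @measurable_fun _ _ (sigma_type (pi_events sources (pred1 (src_bm u)))) R setT
      (fun w => B u t w 0 j).
    apply: (@pi_events_measurable_fun _ _ _ _ _ _ (src_bm u)); first exact: eqxx.
    by exists t, j.
  exact: (measurableT_comp mb measurable_snd).
- by move=> z; rewrite lee_fin bm_ratio_ge0.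
apply: le_integral_nonmeasurable => w _.
  by apply: integral_ge0 => w' _; rewrite lee_fin bm_ratio_ge0.
have := sub_ge0 u w s0; rewrite le_eqVlt => /orP[/eqP Sv|v0].
  rewrite /bm_ratio -Sv.
  under eq_integral do rewrite B0 mxE normr0 powR0 ?gt_eqF// mul0r.
  by rewrite integral0 powR0 ?mulr0 ?mul0r// gt_eqF// divr_gt0.
rewrite /bm_ratio; under eq_integral do rewrite mulrC EFinM.
rewrite ge0_integralZl_EFin ?invr_ge0 ?powR_ge0//; last first.
  apply/measurable_EFinP; apply: (measurableT_comp (measurable_powR a)).
  by apply: measurableT_comp; [exact: normr_measurable|apply: mB; exact: ltW].
rewrite mulrC EFinM lee_wpmul2l ?lee_fin ?invr_ge0 ?powR_ge0// HC//.
  by apply: mB; exact: ltW.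
have := gB 0 (S u s w) j; rewrite lexx v0 subr0 => /(_ isT).
by rewrite /gaussian_law => H A /H <-; congr (P _); apply/funext => w';
  rewrite /= B0 subr0.
Qed.

End particles.

(** * Expected ratios at leaves and at branchings *)

Section moments.
Context {R : realType} {d m : nat} {d0 : measure_display} {Omega : measurableType d0}.
Variable P : probability Omega R.
Variables (tau : seq nat -> Omega -> R) (Ix : seq nat -> Omega -> {ffun 'I_m.+1 -> nat})
  (S : seq nat -> R -> Omega -> R) (B : seq nat -> R -> Omega -> 'rV[R]_d).
Variables (eta : R -> R) (L : seq {ffun 'I_m.+1 -> nat})
  (q : {ffun 'I_m.+1 -> nat} -> R) (rho : R -> R).
Hypothesis pf : particle_family eta L q rho P tau Ix S B.
Hypotheses (eta_bern : bernstein eta) (rho_pos : pos_density rho).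
Local Notation bm_ratio := (bm_ratio S B).
Local Notation sources := (sources tau Ix S B).

(** The quotient is 1 unless its denominator vanishes, in which case it is 0 by convention. *)
Lemma powR_ratio_le1 (v p : R) : 0 <= v -> powR v (2 * p / 2) / powR v p <= 1.
Proof.
move=> v0; rewrite mulrAC mulfV// mul1r.
have [->|vp] := eqVneq (powR v p) 0; first by rewrite mul0r.
by rewrite mulfV.
Qed.

(** By scaling, |B_S|^(2p) has conditional mean at most C S^p, which cancels the denominator. The
    bound therefore depends neither on the time nor on the subordinator. *)
Lemma integral_leaf_ratio (p C : R) u j (s : R) : 0 < p -> 0 <= C -> 0 <= s ->
  (forall v X, 0 < v -> measurable_fun setT X -> gaussian_law P X v ->
    (\int[P]_w (powR `|X w| (2 * p))%:E <= (C * powR v (2 * p / 2))%:E)%E) ->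
  (\int[P]_w (bm_ratio (2 * p) p u j s w w)%:E <= C%:E)%E.
Proof.
move=> p0 C0 s0 HC.
apply: (le_trans (integral_bm_ratio pf p u j _ s0 HC)); first by rewrite mulr_gt0.
apply: (@le_trans _ _ (\int[P]_w (cst C%:E w))%E).
  apply: le_integral_nonmeasurable => w _ /=.
    by rewrite lee_fin !mulr_ge0 ?invr_ge0 ?powR_ge0.
  by rewrite lee_fin -mulrA ler_piMr// powR_ratio_le1// (sub_ge0 pf).
by rewrite integral_cst//= probability_setT mule1.
Qed.

(** Here scaling yields only S^(p/2) against the denominator S^p. The remaining S^(-p/2) is paid for
    by the Laplace integral. *)
Lemma integral_int_ratio (p C C' : R) u j (s : R) : 0 < p -> 0 <= C -> 0 <= C' -> 0 <= s ->
  (forall v X, 0 < v -> measurable_fun setT X -> gaussian_law P X v ->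
    (\int[P]_w (powR `|X w| p)%:E <= (C * powR v (p / 2))%:E)%E) ->
  (forall v, 0 < v -> (((powR v (p / 2))^-1)%:E <=
     C'%:E * \int[@lebesgue_measure R]_(lam in [set` `]0%R, +oo[%R])
     (expR (- (lam * v)) * powR lam (p / 2 - 1))%:E)%E) ->
  (\int[P]_w (bm_ratio p p u j s w w)%:E <= (C * C')%:E * laplace_int eta p s)%E.
Proof.
move=> p0 C0 C'0 s0 HC HC'.
have [_ _ _ subl _] := pf; have [_ _ _ mS [_ _ lapS]] := subl u.
have S0 w : 0 <= S u s w by exact: sub_ge0 pf _ _ _ _.
apply: (le_trans (integral_bm_ratio pf p u j p0 s0 HC)).
apply: (@le_trans _ _ (\int[P]_w (C%:E * ((powR (S u s w) (p / 2))^-1)%:E))%E).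
  apply: le_integral_nonmeasurable => w _ /=.
    by rewrite lee_fin !mulr_ge0 ?invr_ge0 ?powR_ge0.
  rewrite -EFinM lee_fin -mulrA ler_wpM2l//.
  have -> : p = p / 2 + p / 2 by field.
  have := S0 w; rewrite le_eqVlt => /orP[/eqP <-|v0].
    by rewrite !powR0 ?gt_eqF ?addr_gt0 ?divr_gt0 ?addr_gt0 ?divr_gt0// invr0 mul0r.
  have -> : (p / 2 + p / 2) / 2 = p / 2 by field.
  rewrite powRD ?(gt_eqF v0) ?implybT// invfM mulrA mulfV ?mul1r//.
  by rewrite gt_eqF// powR_gt0.
rewrite ge0_integralZl_EFin//; last 2 first.
- by move=> w _; rewrite lee_fin invr_ge0 powR_ge0.
- apply/measurable_EFinP.
  rewrite (_ : (fun w => _) = (fun w => powR (S u s w) (- (p / 2)))).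
    exact: (measurableT_comp (measurable_powR _) (mS _ s0)).
  by apply/funext => w; rewrite powRN.
rewrite EFinM -muleA lee_wpmul2l ?lee_fin//.
apply: (le_trans (neg_moment_laplace P p0 C'0 HC' (mS _ s0) S0)).
rewrite lee_wpmul2l ?lee_fin// /laplace_int le_eqVlt; apply/orP; left; apply/eqP.
apply: eq_integral => lam; rewrite inE/= in_itv/= andbT => lam0.
by rewrite lapS// EFinM.
Qed.

(** The lifetime is independent of the pair (clock, path) of the same particle, so the bound at
    fixed times may be integrated against the density of [tau u]. *)
Lemma integral_int_ratio_tau (p C : R) u j (g : R -> R) : 0 <= C ->
  measurable_fun setT g -> (forall s, 0 <= g s) ->
  (forall s, 0 <= s ->
    (\int[P]_w (bm_ratio p p u j s w w)%:E <= C%:E * laplace_int eta p s)%E) ->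
  (\int[P]_w (g (tau u w) * bm_ratio p p u j (Num.max 0 (tau u w))%R w w)%:E <=
   C%:E * \int[@lebesgue_measure R]_(s in [set` `[0%R, +oo[%R])
      ((g s * rho s)%:E * laplace_int eta p s))%E.
Proof.
move=> C0 mg g0 HC.
(* Lifetimes are nonnegative only almost surely, whereas the processes are controlled at nonnegative
   times only; hence the maximum with 0. *)
have m0 (x : R) : 0 <= Num.max 0 x by rewrite le_max lexx.
have sm := sources_measurable pf.
have [lawtau _ _ _ [_ indep]] := pf.
pose Dtau : pred (seq nat * 'I_4) := pred1 (src_tau u).
pose DSB : pred (seq nat * 'I_4) := pred2 (src_sub u) (src_bm u).
have mtau : @measurable_fun _ _ (sigma_type (pi_events sources Dtau)) R setT (tau u).
  by apply: (@pi_events_measurable_fun _ _ _ _ _ _ (src_tau u)) => //=; exact: eqxx.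
have mtau1 : measurable_fun setT (fun z : sigma_type (pi_events sources Dtau) *
    sigma_type (pi_events sources DSB) => tau u z.1).
  exact: (measurableT_comp mtau measurable_fst).
have mS t : 0 <= t -> @measurable_fun _ _ (sigma_type (pi_events sources DSB)) R setT (S u t).
  move=> t0; apply: (@pi_events_measurable_fun _ _ _ _ _ _ (src_sub u)).
    by apply/orP; left; exact: eqxx.
  by exists t.
have mB t : 0 <= t -> @measurable_fun _ _ (sigma_type (pi_events sources DSB)) R setT
    (fun w => B u t w 0 j).
  move=> t0; apply: (@pi_events_measurable_fun _ _ _ _ _ _ (src_bm u)).
    by apply/orP; right; exact: eqxx.
  by exists t, j.
have /= -> := @mindep_decoupling _ _ _ P _ sources Dtau DSB sm indep _
    (fun z => (g (tau u z.1) * bm_ratio p p u j (Num.max 0 (tau u z.1)) z.2 z.2)%:E);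
    last 3 first.
- by move=> x; apply/negbTE/negP => /andP[/eqP ->] /orP[/eqP[]|/eqP[]].
- apply/measurable_EFinP; apply: measurable_funM.
    exact: (measurableT_comp mg mtau1).
  apply: (measurable_bm_ratio pf p p (E := (sigma_type (pi_events sources Dtau) *
    sigma_type (pi_events sources DSB))%type) (pi := snd) (pi' := snd)) => //.
  + by move=> t t0; exact: (measurableT_comp (mS _ t0) measurable_snd).
  + by move=> t t0; exact: (measurableT_comp (mB _ t0) measurable_snd).
  + by apply: measurable_funTS; apply: measurable_maxr.
- by move=> z; rewrite lee_fin mulr_ge0// bm_ratio_ge0.
have mJ := measurable_laplace_int p eta_bern.
have mgE : measurable_fun setT (fun x => (g x)%:E) by exact/measurable_EFinP.
have J0 s : (0 <= laplace_int eta p s)%E by exact: laplace_int_ge0.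
apply: (@le_trans _ _ (\int[P]_w (C%:E * ((g (tau u w))%:E *
    laplace_int eta p (Num.max 0 (tau u w))%R)))%E).
  apply: le_integral_nonmeasurable => w _.
    by apply: integral_ge0 => w' _; rewrite lee_fin mulr_ge0// bm_ratio_ge0.
  under eq_integral do rewrite EFinM.
  rewrite ge0_integralZl_EFin//; last 2 first.
  - by move=> w' _; rewrite lee_fin bm_ratio_ge0.
  - by apply/measurable_EFinP; exact: (measurable_bm_ratioE pf).
  by rewrite muleCA lee_wpmul2l ?lee_fin// HC.
have mh : measurable_fun setT
    (fun s : R => ((g s)%:E * laplace_int eta p (Num.max 0 s)%R)%E).
  apply: emeasurable_funM => //; apply: (measurableT_comp mJ).
  by apply: measurable_maxr.
rewrite ge0_integralZl_EFin//; last 2 first.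
- by move=> w _; rewrite mule_ge0 ?lee_fin.
- by apply: (measurableT_comp mh); exact: measurable_tau pf u.
rewrite lee_wpmul2l ?lee_fin//.
rewrite (density_law_integral rho_pos (lawtau u) mh); last first.
  by move=> x; rewrite mule_ge0 ?lee_fin.
rewrite le_eqVlt; apply/orP; left; apply/eqP.
apply: eq_integral => s; rewrite inE/= in_itv/= andbT => s0.
by rewrite max_r// muleAC EFinM.
Qed.

End moments.

(** By contradiction: if every initial piece [0, T0/(n+1)] had integral above [eps], the integrals
    over ]T0/(n+1), T0] would stay below the total minus [eps]. By monotone convergence they
    increase to the integral over ]0, T0], which is the total because a point is null. *)
Lemma small_initial_integral {R : realType} (T0 eps : R) (f : R -> \bar R) :
  0 < T0 -> 0 < eps -> measurable_fun setT f -> (forall x, 0 <= f x)%E ->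
  (\int[@lebesgue_measure R]_(s in [set` `[0%R, T0]%R]) f s < +oo)%E ->
  exists T, [/\ 0 < T, T <= T0 &
    (\int[@lebesgue_measure R]_(s in [set` `[0%R, T]%R]) f s <= eps%:E)%E].
Proof.
move=> T00 eps0 mf f0 fT0.
pose t n : R := T0 / n.+1%:R.
have t0 n : 0 < t n by rewrite divr_gt0.
have tT0 n : t n <= T0 by rewrite ler_pdivrMr// ler_peMr ?(ltW T00)// ler1n.
have mfD (D : set R) : measurable_fun D f by apply: measurable_funS mf.
pose I (D : set R) := (\int[@lebesgue_measure R]_(s in D) f s)%E.
have split_int n : (I [set` `[0%R, T0]%R] =
    I [set` `[0%R, t n]%R] + I [set` `]t n, T0]%R])%E.
  rewrite /I (@itv_bndbnd_setU _ _ (BLeft 0) (BRight (t n)) (BRight T0)).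
  - rewrite ge0_integral_setU//=.
    by apply: mfD.
    apply/disj_setPLR => x/=; rewrite !in_itv/= => /andP[_ xt] /andP[tx _].
    by move: (le_lt_trans xt tx); rewrite ltxx.
  - by rewrite bnd_simp ltW.
  - by rewrite bnd_simp.
have I0 D : (0 <= I D)%E by exact: integral_ge0.
apply: contrapT => noT.
have big n : (eps%:E < I [set` `[0%R, t n]%R])%E.
  rewrite ltNge; apply/negP => le; apply: noT; exists (t n); split => //.
have fin : I [set` `[0%R, T0]%R] \is a fin_num by rewrite ge0_fin_numE.
have tail n : (I [set` `]t n, T0]%R] <= I [set` `[0%R, T0]%R] - eps%:E)%E.
  rewrite leeBrDr// (split_int n) [leLHS]addeC; apply: leeD => //; exact: ltW.
have nd : {homo (fun n => [set` `]t n, T0]%R] : set R) : n k / (n <= k)%N >-> (n <= k)%O}.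
  move=> n k nk; apply/subsetPset => x /=; rewrite !in_itv/= => /andP[tx ->].
  by rewrite andbT (le_lt_trans _ tx)// ler_pM2l// lef_pV2 ?posrE// ler_nat ltnS.
have /= cv := @ge0_nondecreasing_set_cvg_integral _ (measurableTypeR R) R
  (fun n => [set` `]t n, T0]%R]) f
  (@lebesgue_measure R) nd (fun=> measurable_itv _) (fun i => mfD _) (fun i x _ => f0 x).
have Ucup : \bigcup_n [set` `]t n, T0]%R] = [set` `]0%R, T0]%R] :> set R.
  apply/seteqP; split => x.
    by move=> [n _ /=]; rewrite !in_itv/= => /andP[tx ->]; rewrite (lt_trans _ tx).
  rewrite /= in_itv/= => /andP[x0 xT]; exists (Num.truncn (T0 / x)) => //=.
  rewrite in_itv/= xT andbT /t ltr_pdivrMr// mulrC -ltr_pdivrMr//.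
  by have /andP[] := truncn_itv (ltW (divr_gt0 T00 x0)).
have E0 : I [set` `]0%R, T0]%R] = I [set` `[0%R, T0]%R].
  by rewrite /I integral_itv_obnd_cbnd.
have lim_le : (I [set` `]0%R, T0]%R] <= I [set` `[0%R, T0]%R] - eps%:E)%E.
  rewrite -Ucup {1}/I -(cvg_lim _ cv)//; apply: lime_le.
    by apply/cvg_ex; eexists; exact: cv.
  exact: nearW.
move: lim_le; rewrite E0 leNgt => /negP; apply.
by rewrite lteBlDr// lteDl// lte_fin.
Qed.

(** * Majorants of the contribution of one particle *)

Section majorants.
Context {R : realType} {d m : nat} {d0 : measure_display} {Omega : measurableType d0}.
Variable P : probability Omega R.
Variables (tau : seq nat -> Omega -> R) (Ix : seq nat -> Omega -> {ffun 'I_m.+1 -> nat})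
  (S : seq nat -> R -> Omega -> R) (B : seq nat -> R -> Omega -> 'rV[R]_d).
Variables (eta : R -> R) (L : seq {ffun 'I_m.+1 -> nat})
  (q : {ffun 'I_m.+1 -> nat} -> R) (rho : R -> R).
Local Notation bm_ratio := (bm_ratio S B).
Local Notation leb := (@lebesgue_measure R).

(** The p-th power of 1/rho(tau) in a branching factor. A branching particle is born at a
    nonnegative time and dies before T, whence the restriction to lifetimes below T. *)
Definition life_wt (p T s : R) : R :=
  \1_([set` `[0, T[%R] : set R) s / powR (rho s) p.

(** The summand 1 serves mark 0 and the sum over all coordinates serves every other mark, so that
    the mark disappears from the bound. [A] is to absorb the coefficients c/q and the power of K
    counting the offspring. *)
Definition int_major (A p T : R) (u : seq nat) (w : Omega) : R :=
  A * (life_wt p T (tau u w) + \sum_(j < d) life_wt p T (tau u w) *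
     bm_ratio p p u j (Num.max 0 (tau u w)) w w).

(** The exponent 2p of the path comes from multiplying the weight by the Lipschitz increment of
    [phi]. *)
Definition leaf_major (A p : R) (u : seq nat) (s : R) (w : Omega) : R :=
  A * (1 + \sum_(j < d) bm_ratio (2 * p) p u j s w w).

Definition rho_wt (p s : R) : \bar R := ((powR (rho s) (p - 1))^-1)%:E.

Lemma rho_wt_ge0 p s : (0 <= rho_wt p s)%E.
Proof. by rewrite lee_fin invr_ge0 powR_ge0. Qed.

Lemma life_wt_ge0 p T s : 0 <= life_wt p T s.
Proof. by rewrite divr_ge0 ?powR_ge0. Qed.

Lemma int_major_ge0 A p T u w : 0 <= A -> 0 <= int_major A p T u w.
Proof.
move=> A0; rewrite mulr_ge0// addr_ge0 ?life_wt_ge0// sumr_ge0// => j _.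
by rewrite mulr_ge0 ?life_wt_ge0 ?bm_ratio_ge0.
Qed.

Lemma leaf_major_ge0 A p u s w : 0 <= A -> 0 <= leaf_major A p u s w.
Proof.
move=> A0; rewrite mulr_ge0// addr_ge0// sumr_ge0// => j _.
exact: bm_ratio_ge0.
Qed.

Hypothesis rho_pos : pos_density rho.

Lemma measurable_rho_powRV p : measurable_fun setT (fun s => (powR (rho s) p)^-1).
Proof.
have [mrho _ _] := rho_pos.
rewrite (_ : (fun s => _) = (fun s => powR (rho s) (- p))).
  exact: (measurableT_comp (measurable_powR _) mrho).
by apply/funext => s; rewrite powRN.
Qed.

Lemma measurable_rho_wt p : measurable_fun setT (rho_wt p).
Proof. by apply/measurable_EFinP; exact: measurable_rho_powRV. Qed.

Lemma measurable_life_wt p T : measurable_fun setT (life_wt p T).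
Proof.
by apply: measurable_funM; [exact: measurable_indic|exact: measurable_rho_powRV].
Qed.

(** The density of the lifetime cancels one of the p powers of [rho]; this is the origin of
    rho^(p-1) in the two conditions. *)
Lemma life_wt_rho p T s : 0 <= s ->
  life_wt p T s * rho s = \1_([set` `[0, T[%R] : set R) s / powR (rho s) (p - 1).
Proof.
move=> s0; have [_ rho0 _] := rho_pos; have r0 := rho0 _ s0.
rewrite /life_wt -mulrA; congr (_ * _).
have -> : powR (rho s) p = rho s * powR (rho s) (p - 1).
  rewrite -[X in X * _]powRr1 ?(ltW r0)// -powRD ?(gt_eqF r0) ?implybT//.
  by rewrite addrC subrK.
by rewrite invfM mulrAC mulVf ?mul1r// gt_eqF.
Qed.

Lemma integral_life_wt_le (p T : R) (J : R -> \bar R) : (forall s, 0 <= J s)%E ->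
  (\int[leb]_(s in [set` `[0%R, +oo[%R]) ((life_wt p T s * rho s)%:E * J s) <=
   \int[leb]_(s in [set` `[0%R, T]%R]) (rho_wt p s * J s))%E.
Proof.
move=> J0; have [_ rho0 _] := rho_pos.
rewrite integral_mkcond [leRHS]integral_mkcond.
apply: le_integral_nonmeasurable => s _; rewrite /patch; case: ifPn => //.
  rewrite inE/= in_itv/= andbT => s0; rewrite mule_ge0// lee_fin.
  by rewrite mulr_ge0 ?life_wt_ge0// ltW// rho0.
  rewrite inE/= in_itv/= andbT => s0; rewrite life_wt_rho// indicE.
  case: ifPn => [|].
    rewrite inE/= in_itv/= s0/= => sT; rewrite lee_wpmul2r// lee_fin.
    by rewrite ler_piMl ?invr_ge0 ?powR_ge0// lern1 leq_b1.
  rewrite notin_setE/= in_itv/= s0/= => sT.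
  rewrite memNset ?mul0r ?mul0e//= in_itv/= s0/= => sT'.
  by apply: sT; exact: ltW.
by move=> _; case: ifPn => // _; rewrite mule_ge0// rho_wt_ge0.
Qed.

Hypothesis pf : particle_family eta L q rho P tau Ix S B.
Hypothesis eta_bern : bernstein eta.

Section joint_measurability.
Context {dE : measure_display} {E : measurableType dE}.
Variables (u : seq nat) (pi : E -> Omega).
Hypothesis mtau : measurable_fun setT (tau u \o pi).
Hypothesis mS : forall t, 0 <= t -> measurable_fun setT (S u t \o pi).
Hypothesis mB : forall t j, 0 <= t -> measurable_fun setT (fun e => B u t (pi e) 0 j).

Lemma measurable_int_major (A p T : R) :
  measurable_fun setT (int_major A p T u \o pi).
Proof.
have ml : measurable_fun setT (fun e => life_wt p T (tau u (pi e))).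
  exact: (measurableT_comp (measurable_life_wt p T) mtau).
apply: measurable_funM => //; apply: measurable_funD => //.
apply: measurable_sum => j; apply: measurable_funM => //.
apply: (measurable_bm_ratio pf) => //.
- by move=> t; exact: mB.
- by apply: measurable_maxr.
- by move=> e; rewrite le_max lexx.
Qed.

Lemma measurable_leaf_major (A p : R) (s : E -> R) :
  measurable_fun setT s -> (forall e, 0 <= s e) ->
  measurable_fun setT (fun e => leaf_major A p u (s e) (pi e)).
Proof.
move=> ms s0; apply: measurable_funM => //; apply: measurable_funD => //.
apply: measurable_sum => j; apply: (measurable_bm_ratio pf) => //.
by move=> t; exact: mB.
Qed.

End joint_measurability.

(** The two integrals on the right are those of [cond_rho] and [cond_eta], cut off at [T]. They can
    be made small through the choice of [T]. *)
Lemma expect_int_major (A p T C : R) u : 0 <= A -> 0 <= C ->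
  (forall j s, 0 <= s ->
    (\int[P]_w (bm_ratio p p u j s w w)%:E <= C%:E * laplace_int eta p s)%E) ->
  (\int[P]_w (int_major A p T u w)%:E <= A%:E *
    (\int[leb]_(s in [set` `[0%R, T]%R]) rho_wt p s + (d%:R * C)%:E *
     \int[leb]_(s in [set` `[0%R, T]%R]) (rho_wt p s * laplace_int eta p s)))%E.
Proof.
move=> A0 C0 HC.
have [lawtau _ _ subl [bml _]] := pf.
have mtau := measurable_tau pf u.
have ml := measurable_life_wt p T.
have mlt : measurable_fun setT (fun w => life_wt p T (tau u w)).
  exact: (measurableT_comp ml mtau).
have mr j : measurable_fun setT (fun w => life_wt p T (tau u w) *
     bm_ratio p p u j (Num.max 0 (tau u w)) w w).
  apply: measurable_funM => //.
  apply: (@measurable_bm_ratio _ _ _ _ _ P _ _ _ _ _ _ _ _ pf _ _ _ _ _ _ id id) => //.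
  - by have [_ _ _ mS _] := subl u.
  - by have [_ _ mB _ _] := bml u => t t0; exact: mB.
  - by apply: measurable_maxr.
  - by move=> e; rewrite le_max lexx.
under eq_integral do rewrite /int_major EFinM EFinD -sumEFin.
rewrite ge0_integralZl_EFin//; last 2 first.
- move=> w _; rewrite adde_ge0 ?lee_fin ?life_wt_ge0// sume_ge0// => j _.
  by rewrite lee_fin mulr_ge0 ?life_wt_ge0 ?bm_ratio_ge0.
- apply: emeasurable_funD; first exact/measurable_EFinP.
  by apply: emeasurable_sum => j; exact/measurable_EFinP.
rewrite lee_wpmul2l ?lee_fin//.
rewrite ge0_integralD//; last 4 first.
- by move=> w _; rewrite lee_fin life_wt_ge0.
- exact/measurable_EFinP.
- move=> w _; rewrite sume_ge0// => j _.
  by rewrite lee_fin mulr_ge0 ?life_wt_ge0 ?bm_ratio_ge0.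
- by apply: emeasurable_sum => j; exact/measurable_EFinP.
apply: leeD.
  have mE : measurable_fun setT (fun s => (life_wt p T s)%:E) by exact/measurable_EFinP.
  rewrite (density_law_integral rho_pos (lawtau u) mE); last first.
    by move=> s; rewrite lee_fin life_wt_ge0.
  have := @integral_life_wt_le p T (fun=> 1%E) (fun=> lee01).
  under eq_integral do rewrite mule1 EFinM.
  by under [in X in (_ <= X)%E -> _]eq_integral do rewrite mule1.
rewrite ge0_integral_sum//; last 2 first.
- by move=> j; exact/measurable_EFinP.
- by move=> j w _; rewrite lee_fin mulr_ge0 ?life_wt_ge0 ?bm_ratio_ge0.
apply: (@le_trans _ _ (\sum_(j < d) (C%:E *
   \int[leb]_(s in [set` `[0%R, T]%R]) (rho_wt p s * laplace_int eta p s)))%E).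
  apply: lee_sum => j _.
  apply: (le_trans (integral_int_ratio_tau pf eta_bern rho_pos C0 ml _ (HC j))).
    by move=> s; exact: life_wt_ge0.
  rewrite lee_wpmul2l ?lee_fin// integral_life_wt_le// => s.
  exact: laplace_int_ge0.
rewrite sumr_const card_ord -[leLHS]mule_natl muleA -EFinM.
by rewrite lexx.
Qed.

(** The bound is free of [s], so it can serve to define K before T is known. *)
Lemma expect_leaf_major (A p C : R) u (s : R) : 0 <= A -> 0 < p -> 0 <= C -> 0 <= s ->
  (forall v X, 0 < v -> measurable_fun setT X -> gaussian_law P X v ->
    (\int[P]_w (powR `|X w| (2 * p))%:E <= (C * powR v (2 * p / 2))%:E)%E) ->
  (\int[P]_w (leaf_major A p u s w)%:E <= (A * (1 + d%:R * C))%:E)%E.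
Proof.
move=> A0 p0 C0 s0 HC.
have mr j : measurable_fun setT (fun w => bm_ratio (2 * p) p u j s w w).
  exact: (measurable_bm_ratioE pf).
under eq_integral do rewrite /leaf_major EFinM EFinD -sumEFin.
rewrite ge0_integralZl_EFin//; last 2 first.
- move=> w _; rewrite adde_ge0// sume_ge0// => j _.
  by rewrite lee_fin bm_ratio_ge0.
- apply: emeasurable_funD => //.
  by apply: emeasurable_sum => j; exact/measurable_EFinP.
rewrite EFinM lee_wpmul2l ?lee_fin//.
rewrite ge0_integralD//; last 2 first.
- by move=> w _; rewrite sume_ge0// => j _; rewrite lee_fin bm_ratio_ge0.
- by apply: emeasurable_sum => j; exact/measurable_EFinP.
rewrite EFinD; apply: leeD.
  by rewrite integral_cst//= probability_setT mule1.
rewrite ge0_integral_sum//; last 2 first.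
- by move=> j; exact/measurable_EFinP.
- by move=> j w _; rewrite lee_fin bm_ratio_ge0.
apply: (@le_trans _ _ (\sum_(j < d) C%:E)%E).
  by apply: lee_sum => j _; exact: (integral_leaf_ratio pf).
by rewrite sumEFin sumr_const card_ord mulr_natl.
Qed.

End majorants.

(** * The tree and its supermartingale *)

Section states.
Context {R : realType} {d m : nat} {d0 : measure_display} {Omega : measurableType d0}.
Variables (tau : seq nat -> Omega -> R) (Ix : seq nat -> Omega -> {ffun 'I_m.+1 -> nat})
  (S : seq nat -> R -> Omega -> R) (B : seq nat -> R -> Omega -> 'rV[R]_d).
Local Notation walk := (walk tau Ix S B).
Local Notation child := (child tau Ix S B).
Local Notation pst := (pst tau Ix S B).

Lemma walk_rcons T pre lab j w (st : pstate R d) :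
  walk T pre (rcons lab j) w st =
  child T (pre ++ lab) j w (walk T pre lab w st).
Proof.
elim: lab pre st => [|k lab IH] pre st /=; first by rewrite cats0.
by rewrite IH cat_rcons.
Qed.

Lemma pst_rcons T t x i w u j :
  pst T t x i w (rcons u j) = child T u j w (pst T t x i w u).
Proof. by rewrite /Defs.pst walk_rcons. Qed.

(** [alive] means that the word is a particle of the tree, not that it survives until some time.
    Position 0 and mark 0 are a reference choice, immaterial by [pst_alive_born]. *)
Definition alive T t u w : bool := (pst T t 0 0%N w u).1.1.1.
Definition born T t u w : R := (pst T t 0 0%N w u).1.1.2.

Lemma pst_alive_born T t x i w u :
  (pst T t x i w u).1.1 = (alive T t u w, born T t u w).
Proof.
rewrite /alive /born; elim/last_ind: u => [//|u j].
rewrite !pst_rcons /Defs.child.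
case: (pst T t x i w u) => [[[a b] y] k].
by case: (pst T t 0 0%N w u) => [[[a' b'] y'] k'] /= [-> ->].
Qed.

Lemma alive_rcons T t u j w : alive T t (rcons u j) w =
  [&& alive T t u w, born T t u w + tau u w < T & (j < lsize (Ix u w))%N].
Proof.
rewrite /alive /born pst_rcons /Defs.child.
by case: (pst T t 0 0%N w u) => [[[a b] y] k] /=; rewrite andbA.
Qed.

Lemma born_rcons T t u j w : born T t (rcons u j) w = born T t u w + tau u w.
Proof.
rewrite /born pst_rcons /Defs.child.
by case: (pst T t 0 0%N w u) => [[[a b] y] k].
Qed.

Lemma alive_born_itv T t u w : 0 <= t <= T -> (forall v, 0 <= tau v w) ->
  alive T t u w -> 0 <= born T t u w <= T.
Proof.
move=> tT tau0; elim/last_ind: u => [//|u j IH].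
rewrite alive_rcons born_rcons => /and3P[/IH /andP[b0 _] bT _].
by rewrite addr_ge0//= ltW.
Qed.

Section measurability.
Context {dE : measure_display} {E : measurableType dE}.
Variables (z : seq nat) (pi : E -> Omega).
Hypothesis mtau : forall v, v != z -> measurable_fun setT (tau v \o pi).
Hypothesis mIx : forall v r, v != z ->
  measurable_fun setT (fun e => ((Ix v (pi e) r)%:R : R)).

(** Membership and birth time of [u] read only the strict prefixes of [u]. These are shorter than
    [z], hence different from it, so the sources of [z] do not intervene even for u = z. *)
Lemma measurable_alive_born T t u : (size u <= size z)%N ->
  measurable_fun setT (fun e => alive T t u (pi e)) /\
  measurable_fun setT (fun e => born T t u (pi e)).
Proof.
elim/last_ind: u => [_|u j IH].
  by split; [apply: measurable_cst|apply: measurable_cst].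
rewrite size_rcons => uz; have [ma mb] := IH (ltnW uz).
have uneqz : u != z by apply: contraTneq uz => ->; rewrite ltnn.
have mbt : measurable_fun setT (fun e => born T t u (pi e) + tau u (pi e)).
  by apply: measurable_funD => //; exact: mtau.
split; last by under eq_fun do rewrite born_rcons.
under eq_fun do rewrite alive_rcons.
apply: measurable_and => //; apply: measurable_and.
  by apply: measurable_fun_ltr => //; exact: measurable_cst.
rewrite (_ : (fun e => (j < lsize (Ix u (pi e)))%N) =
    (fun e => j%:R < \sum_(r < m.+1) (Ix u (pi e) r)%:R :> R)).
  apply: measurable_fun_ltr; first exact: measurable_cst.
  by apply: measurable_sum => r; exact: mIx.
by apply/funext => e; rewrite -natr_sum ltr_nat.
Qed.

End measurability.
End states.

Section supermartingale.
Context {R : realType} {d m : nat} {d0 : measure_display} {Omega : measurableType d0}.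
Variable P : probability Omega R.
Variables (tau : seq nat -> Omega -> R) (Ix : seq nat -> Omega -> {ffun 'I_m.+1 -> nat})
  (S : seq nat -> R -> Omega -> R) (B : seq nat -> R -> Omega -> 'rV[R]_d).
Variables (eta : R -> R) (L : seq {ffun 'I_m.+1 -> nat})
  (q : {ffun 'I_m.+1 -> nat} -> R) (rho : R -> R).
Hypothesis pf : particle_family eta L q rho P tau Ix S B.
Hypothesis rho_pos : pos_density rho.
Variables (A1 A2 p T t K : R).
Local Notation alive := (alive tau Ix S B T t).
Local Notation born := (born tau Ix S B T t).
Local Notation sources := (sources tau Ix S B).

(* w carries the past (state of u), w' the inputs of u itself, so that the
   expectation over w' alone is the conditional expectation given the past. *)
Definition step (u : seq nat) (w w' : Omega) : R :=
  if alive u w then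
    K^-1 * (int_major tau S B rho A1 p T u w' +
            leaf_major S B A2 p u (Num.max 0 (T - born u w)) w')
  else 1.

Hypotheses (A1_ge0 : 0 <= A1) (A2_ge0 : 0 <= A2) (K_gt0 : 0 < K).

Lemma step_ge0 u w w' : 0 <= step u w w'.
Proof.
rewrite /step; case: ifPn => // _.
by rewrite mulr_ge0 ?invr_ge0 ?(ltW K_gt0)// addr_ge0 ?int_major_ge0 ?leaf_major_ge0.
Qed.

Lemma measurable_step {dE : measure_display} {E : measurableType dE}
    (u : seq nat) (pi pi' : E -> Omega) :
  (forall v, v != u -> measurable_fun setT (tau v \o pi)) ->
  (forall v r, v != u -> measurable_fun setT (fun e => ((Ix v (pi e) r)%:R : R))) ->
  measurable_fun setT (tau u \o pi') ->
  (forall s, 0 <= s -> measurable_fun setT (S u s \o pi')) ->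
  (forall s j, 0 <= s -> measurable_fun setT (fun e => B u s (pi' e) 0 j)) ->
  measurable_fun setT (fun e => step u (pi e) (pi' e)).
Proof.
move=> mtau mIx mtau' mS mB.
have [ma mb] := measurable_alive_born S B mtau mIx T t (leqnn (size u)).
apply: measurable_fun_ifT => //.
apply: measurable_funM => //; apply: measurable_funD.
  exact: (measurable_int_major rho_pos pf).
apply: (measurable_leaf_major pf) => //; last by move=> e; rewrite le_max lexx.
by apply: measurable_maxr => //; exact: measurable_funB.
Qed.

Hypothesis int_le : forall u, (\int[P]_w (int_major tau S B rho A1 p T u w)%:E <= (K / 2)%:E)%E.
Hypothesis leaf_le : forall u s, 0 <= s ->
  (\int[P]_w (leaf_major S B A2 p u s w)%:E <= (K / 2)%:E)%E.

Let mS u s : 0 <= s -> measurable_fun setT (S u s).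
Proof. by move=> s0; have [_ _ _ /(_ u)[_ _ _ + _] _] := pf; exact. Qed.

Let mB u s j : 0 <= s -> measurable_fun setT (fun w => B u s w 0 j).
Proof. by move=> s0; have [_ _ _ _ [/(_ u)[_ _ + _ _] _]] := pf; exact. Qed.

(** For a word of the tree each of the two parts has mean at most K/2, and the factor 1/K normalises
    their sum; other words contribute the constant 1. *)
Lemma expect_step_le1 u w : (\int[P]_w' (step u w w')%:E <= 1)%E.
Proof.
rewrite /step; case: (alive u w); last first.
  by rewrite integral_cst//= probability_setT mule1.
have mi : measurable_fun setT (fun w => (int_major tau S B rho A1 p T u w)%:E).
  apply/measurable_EFinP; apply: (measurable_int_major rho_pos pf (pi := id)).
  - exact: measurable_tau pf u.
  - by move=> s; exact: mS.
  - by move=> s j; exact: mB.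
set s := Num.max _ _; have s0 : 0 <= s by rewrite le_max lexx.
have ml : measurable_fun setT (fun w => (leaf_major S B A2 p u s w)%:E).
  apply/measurable_EFinP; apply: (measurable_leaf_major pf (pi := id)) => //.
  - by move=> r; exact: mS.
  - by move=> r j; exact: mB.
have i0 w' : (0 <= (int_major tau S B rho A1 p T u w')%:E)%E.
  by rewrite lee_fin int_major_ge0.
have l0 w' : (0 <= (leaf_major S B A2 p u s w')%:E)%E.
  by rewrite lee_fin leaf_major_ge0.
under eq_integral do rewrite EFinM EFinD.
rewrite ge0_integralZl_EFin ?invr_ge0 ?(ltW K_gt0)//; last 2 first.
- by move=> w' _; exact: adde_ge0.
- exact: emeasurable_funD.
rewrite ge0_integralD//.
apply: (@le_trans _ _ ((K^-1)%:E * ((K / 2)%:E + (K / 2)%:E))%E).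
  rewrite lee_wpmul2l ?lee_fin ?invr_ge0 ?(ltW K_gt0)//.
  by apply: leeD; [exact: int_le|exact: leaf_le].
rewrite -EFinD -EFinM lee_fin le_eqVlt; apply/orP; left; apply/eqP.
by field; rewrite gt_eqF.
Qed.

Lemma measurable_prod_step (U : seq (seq nat)) :
  measurable_fun setT (fun w => (\prod_(u <- U) step u w w)%:E).
Proof.
apply/measurable_EFinP; apply: measurable_prod => u _.
apply: (measurable_step (pi := id) (pi' := id)).
- by move=> v _; exact: measurable_tau pf v.
- by move=> v r _; exact: measurable_Ix pf v r.
- exact: measurable_tau pf u.
- by move=> s; exact: mS.
- by move=> s j; exact: mB.
Qed.

(** Induction on the last word [z]. As lengths are nondecreasing, [z] is a proper prefix of no word
    of [V], so the product over [V] does not read the sources of [z]. Integrating these first leaves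
    a factor at most 1. *)
Lemma expect_prod_step_le1 (U : seq (seq nat)) : uniq U ->
  sorted (fun u v : seq nat => (size u <= size v)%N) U ->
  (\int[P]_w (\prod_(u <- U) step u w w)%:E <= 1)%E.
Proof.
elim/last_ind: U => [_ _|V z IH].
  by under eq_integral do rewrite big_nil; rewrite integral_cst//= probability_setT mule1.
rewrite rcons_uniq => /andP[zV uV] sV.
have Vz u : u \in V -> (size u <= size z)%N.
  move=> uVin; move: sV; rewrite sorted_pairwise; last first.
    by move=> a b c; exact: leq_trans.
  by rewrite pairwise_rcons => /andP[/allP/(_ _ uVin)].
have sV' : sorted (fun u v : seq nat => (size u <= size v)%N) V.
  by move: sV; rewrite -cats1 => /cat_sorted2[].
have sm := sources_measurable pf.
have [_ _ _ _ [_ indep]] := pf.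
pose D1 : pred (seq nat * 'I_4) := fun x => x.1 != z.
pose D2 : pred (seq nat * 'I_4) := fun x => x.1 == z.
pose E1 := sigma_type (pi_events sources D1); pose E2 := sigma_type (pi_events sources D2).
have mtau1 v : v != z -> @measurable_fun _ _ E1 R setT (tau v).
  by move=> vz; apply: (@pi_events_measurable_fun _ _ _ _ _ _ (src_tau v)).
have mIx1 v r : v != z -> @measurable_fun _ _ E1 R setT (fun w => ((Ix v w r)%:R : R)).
  move=> vz; apply: (@pi_events_measurable_fun _ _ _ _ _ _ (src_idx v)) => //.
  by exists r.
have mS1 v s : v != z -> 0 <= s -> @measurable_fun _ _ E1 R setT (S v s).
  move=> vz s0; apply: (@pi_events_measurable_fun _ _ _ _ _ _ (src_sub v)) => //.
  by exists s.
have mB1 v s j : v != z -> 0 <= s -> @measurable_fun _ _ E1 R setT (fun w => B v s w 0 j).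
  move=> vz s0; apply: (@pi_events_measurable_fun _ _ _ _ _ _ (src_bm v)) => //.
  by exists s, j.
have mtau2 : @measurable_fun _ _ E2 R setT (tau z).
  by apply: (@pi_events_measurable_fun _ _ _ _ _ _ (src_tau z)) => //; exact: eqxx.
have mS2 s : 0 <= s -> @measurable_fun _ _ E2 R setT (S z s).
  move=> s0; apply: (@pi_events_measurable_fun _ _ _ _ _ _ (src_sub z)); first exact: eqxx.
  by exists s.
have mB2 s j : 0 <= s -> @measurable_fun _ _ E2 R setT (fun w => B z s w 0 j).
  move=> s0; apply: (@pi_events_measurable_fun _ _ _ _ _ _ (src_bm z)); first exact: eqxx.
  by exists s, j.
have mV : @measurable_fun _ _ E1 R setT (fun w => \prod_(u <- V) step u w w).
  apply: measurable_prod => u uVin.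
  have uz : u != z by apply: contraNneq zV => <-.
  rewrite /step.
  have [ma mb] := measurable_alive_born (E := E1) (pi := id) S B mtau1 mIx1 T t (Vz _ uVin).
  apply: measurable_fun_ifT => //.
  apply: measurable_funM => //; apply: measurable_funD.
    apply: (measurable_int_major rho_pos pf (E := E1) (pi := id)).
    - exact: mtau1.
    - by move=> s; exact: mS1.
    - by move=> s j; exact: mB1.
  apply: (measurable_leaf_major pf (E := E1) (pi := id)).
  - by move=> s; exact: mS1.
  - by move=> s j; exact: mB1.
  - by apply: measurable_maxr => //; exact: measurable_funB.
  - by move=> e; rewrite le_max lexx.
have V0 w : 0 <= \prod_(u <- V) step u w w by apply: prodr_ge0 => u _; exact: step_ge0.
(* In the decoupled pair, [w] feeds the product over [V] and the birth of [z], while [w'] feeds the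
   lifetime, clock and path of [z]. *)
under eq_integral do rewrite -cats1 big_cat big_seq1 /=.
have /= -> := @mindep_decoupling _ _ _ P _ sources D1 D2 sm indep _
  (fun x => (\prod_(u <- V) step u x.1 x.1 * step z x.1 x.2)%:E); last 3 first.
- by move=> x; apply/negbTE/negP => /andP[/negP xz]; exact: xz.
- apply/measurable_EFinP; apply: measurable_funM.
    exact: (measurableT_comp mV measurable_fst).
  apply: (measurable_step (E := (E1 * E2)%type) (pi := fst) (pi' := snd)).
  + by move=> v vz; exact: (measurableT_comp (mtau1 _ vz) measurable_fst).
  + by move=> v r vz; exact: (measurableT_comp (mIx1 _ r vz) measurable_fst).
  + exact: (measurableT_comp mtau2 measurable_snd).
  + by move=> s s0; exact: (measurableT_comp (mS2 _ s0) measurable_snd).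
  + by move=> s j s0; exact: (measurableT_comp (mB2 _ j s0) measurable_snd).
- by move=> x; rewrite lee_fin mulr_ge0// step_ge0.
apply: le_trans (IH uV sV').
apply: le_integral_nonmeasurable => w _.
  by apply: integral_ge0 => w' _; rewrite lee_fin mulr_ge0// step_ge0.
have mst : measurable_fun setT (fun w' => (step z w w')%:E).
  apply/measurable_EFinP; apply: (measurable_step (pi := fun=> w) (pi' := id)).
  - by move=> v _; exact: measurable_cst.
  - by move=> v r _; exact: measurable_cst.
  - exact: measurable_tau pf z.
  - by move=> s; exact: mS.
  - by move=> s j; exact: mB.
under eq_integral do rewrite EFinM.
rewrite ge0_integralZl_EFin//; last by move=> w' _; rewrite lee_fin step_ge0.
by rewrite -[leRHS]mule1 lee_wpmul2l ?lee_fin// expect_step_le1.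
Qed.

End supermartingale.

(** * The pointwise majorant *)

Section tail_function.
Context {R : realType}.
Variable rho : R -> R.
Hypothesis rho_pos : pos_density rho.
Local Notation leb := (@lebesgue_measure R).
Local Notation tail z := [set` `[z, +oo[%R].

Let tail_int (z : R) : \bar R := (\int[leb]_(s in tail z) (rho s)%:E)%E.

Let mrho (D : set R) : measurable_fun D (fun s => (rho s)%:E).
Proof.
by have [m _ _] := rho_pos; apply/measurable_EFinP; exact: measurable_funS m.
Qed.

Let tail_int_anti (y z : R) : 0 <= y <= z -> (tail_int z <= tail_int y)%E.
Proof.
move=> /andP[y0 yz]; have [_ rho0 _] := rho_pos.
apply: ge0_subset_integral => //.
- exact: mrho.
- move=> s; rewrite /= in_itv/= andbT => ys.
  by rewrite lee_fin ltW// rho0// (le_trans y0).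
- by apply: subset_itvr; rewrite bnd_simp.
Qed.

Let tail_int_fin (z : R) : 0 <= z -> tail_int z \is a fin_num.
Proof.
move=> z0; have [_ rho0 rho1] := rho_pos; rewrite ge0_fin_numE.
  apply: (@le_lt_trans _ _ (tail_int 0)); first by apply: tail_int_anti; rewrite lexx.
  by rewrite /tail_int rho1 ltry.
apply: integral_ge0 => s; rewrite /= in_itv/= andbT => zs.
by rewrite lee_fin ltW// rho0// (le_trans z0).
Qed.

(** Used to bound the leaf denominators below by [Fbar rho T0]. The value at [T0], rather than at
    the final T, lets the leaf constants be fixed before T. *)
Lemma Fbar_anti (y z : R) : 0 <= y <= z -> Fbar rho z <= Fbar rho y.
Proof.
move=> /andP[y0 yz]; apply: fine_le; [exact: tail_int_fin (le_trans y0 yz)|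
  exact: tail_int_fin|by apply: tail_int_anti; rewrite y0].
Qed.

(** A vanishing tail integral would force rho = 0 almost everywhere on [z, z + 1], a set of measure
    1 on which [rho] is positive. *)
Lemma Fbar_gt0 (z : R) : 0 <= z -> 0 < Fbar rho z.
Proof.
move=> z0; have [_ rho0 _] := rho_pos.
have rz s : tail z s -> 0 < rho s.
  by rewrite /= in_itv/= andbT => zs; rewrite rho0// (le_trans z0).
rewrite fine_gt0// -ge0_fin_numE ?integral_ge0//; last first.
  by move=> s /rz /ltW; rewrite lee_fin.
rewrite tail_int_fin// andbT lt0e integral_ge0 ?andbT//; last first.
  by move=> s /rz /ltW; rewrite lee_fin.
apply/eqP => I0.
have : ae_eq leb (tail z) (fun s => (rho s)%:E) (cst 0%E).
  apply/ae_eq_integral_abs => //; first exact: mrho.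
  rewrite -[RHS]I0; apply: eq_integral => s /set_mem /rz r0.
  by rewrite gee0_abs// lee_fin ltW.
move=> [N [mN N0 sN]].
have : (leb [set` `[z, z + 1]%R] <= leb N)%E.
  apply: le_measure; rewrite ?inE// => s /=; rewrite in_itv/= => /andP[zs _].
  have : 0 < rho s by apply: rz; rewrite /= in_itv/= zs.
  move=> rs0; apply: sN => /=; rewrite in_itv/= zs/= => /(_ isT) [rs].
  by rewrite rs ltxx in rs0.
rewrite N0 lebesgue_measure_itv/= lte_fin ltrDl ltr01 -EFinD lee_fin.
by rewrite addrAC subrr add0r ler10.
Qed.

End tail_function.

Section vectors.
Context {R : realType} {d : nat}.
Implicit Types (b : 'rV[R]_d) (p s : R).

(** Through the largest term: the sum is at most d times it, and its p-th power is one of the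
    summands on the right. *)
Lemma powR_sum_le (y : 'I_d -> R) p : 0 < p -> (forall j, 0 <= y j) ->
  powR (\sum_(j < d) y j) p <= powR d%:R p * \sum_(j < d) powR (y j) p.
Proof.
move=> p0 y0; case: d y y0 => [|n] y y0.
  by rewrite !big_ord0 mulr0 powR0// gt_eqF.
pose k := [arg max_(i > ord0) y i]%O.
have kP j : y j <= y k by rewrite /k; case: arg_maxP => // i _; apply.
apply: (@le_trans _ _ (powR (n.+1%:R * y k) p)).
  rewrite ge0_ler_powR ?nnegrE ?(ltW p0)//.
  - exact: sumr_ge0.
  - by rewrite mulr_ge0.
  - have -> : n.+1%:R * y k = \sum_(j < n.+1) y k.
      by rewrite sumr_const card_ord mulr_natl.
    exact: ler_sum.
rewrite powRM// ler_wpM2l ?powR_ge0// (bigD1 k)//= lerDl.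
by apply: sumr_ge0 => j _; exact: powR_ge0.
Qed.

(** Summing over all coordinates removes the dependence on [j]; an index outside the range has
    coordinate 0 by convention. *)
Lemma normr_vcoord_div_powR b s p j : 0 < p -> 0 <= s ->
  powR `|vcoord b j / s| p <= \sum_(k < d) powR `|b 0 k| p / powR s p.
Proof.
move=> p0 s0; have pos k : 0 <= powR `|b 0 k| p / powR s p by rewrite divr_ge0 ?powR_ge0.
rewrite /vcoord; case: insubP => [k _ _|_].
  rewrite (bigD1 k)//= normrM normfV (ger0_norm s0) powRM ?invr_ge0//.
  rewrite -(powR_inv1 s0) -powRrM mulN1r powRN lerDl.
  by apply: sumr_ge0 => i _.
by rewrite mul0r normr0 powR0 ?gt_eqF//; apply: sumr_ge0.
Qed.

Lemma enorm_vcoord_le b j : enorm b * `|vcoord b j| <= \sum_(k < d) b 0 k ^+ 2.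
Proof.
have s0 : 0 <= \sum_(k < d) b 0 k ^+ 2 by apply: sumr_ge0 => k _; exact: sqr_ge0.
rewrite /vcoord; case: insubP => [k _ _|_]; last by rewrite normr0 mulr0.
apply: (@le_trans _ _ (enorm b * enorm b)).
  rewrite ler_wpM2l ?sqrtr_ge0// -sqrtr_sqr ler_wsqrtr// (bigD1 k)//= lerDl.
  by apply: sumr_ge0 => i _; exact: sqr_ge0.
by rewrite -expr2 sqr_sqrtr.
Qed.

Lemma powR_sqr_div (y s p : R) : 0 <= s ->
  powR (y ^+ 2 / s) p = powR `|y| (2 * p) / powR s p.
Proof.
move=> s0; rewrite powRM ?sqr_ge0 ?invr_ge0//.
rewrite -(powR_inv1 s0) -powRrM mulN1r powRN; congr (_ / _).
by rewrite -real_normK ?num_real// -powR_mulrn// -powRrM.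
Qed.

End vectors.

Section pointwise.
Context {R : realType} {d m : nat} {d0 : measure_display} {Omega : measurableType d0}.
Variables (tau : seq nat -> Omega -> R) (Ix : seq nat -> Omega -> {ffun 'I_m.+1 -> nat})
  (S : seq nat -> R -> Omega -> R) (B : seq nat -> R -> Omega -> 'rV[R]_d).
Variables (L : seq {ffun 'I_m.+1 -> nat}) (q : {ffun 'I_m.+1 -> nat} -> R) (rho : R -> R).
Variables (c : {ffun 'I_m.+1 -> nat} -> R -> 'rV[R]_d -> R) (phi : 'rV[R]_d -> R).
Variables (T0 T t p K A1 A2 M Lip : R) (Cc : {ffun 'I_m.+1 -> nat} -> R).
Local Notation alive := (alive tau Ix S B T t).
Local Notation born := (born tau Ix S B T t).
Local Notation step := (step tau Ix S B rho A1 A2 p T t K).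
Hypotheses (rho_pos : pos_density rho) (p0 : 0 < p).
Hypotheses (tT : 0 <= t <= T) (TT0 : T <= T0).
Hypothesis q0 : forall l, l \in L -> 0 < q l.
Hypothesis cb : forall l s x, l \in L -> 0 <= s <= T0 -> `|c l s x| <= Cc l.
Hypothesis phib : forall x, `|phi x| <= M.
Hypothesis phiL : forall x y, `|phi x - phi y| <= Lip * enorm (x - y).
Hypotheses (A1_ge0 : 0 <= A1) (A2_ge0 : 0 <= A2) (K1 : 1 <= K).
Hypothesis A1P : forall l, l \in L -> powR (Cc l / q l) p * K ^+ lsize l <= A1.
Hypothesis A2M : powR (M / Fbar rho T0) p <= A2.
Hypothesis A2L : powR (Lip / Fbar rho T0) p * powR d%:R p <= A2.
Hypothesis Lip0 : 0 <= Lip.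

Variable w : Omega.
Hypothesis tau0 : forall v, 0 <= tau v w.
Hypothesis IxL : forall v, Ix v w \in L.
Hypothesis S0 : forall u s, 0 <= s -> 0 <= S u s w.

Definition nchildren (u : seq nat) : nat :=
  if born u w + tau u w < T then lsize (Ix u w) else 0.

Lemma mark_weight_le (b : 'rV[R]_d) (s : R) (th : nat) : 0 <= s ->
  powR `|if th == 0%N then 1 else vcoord b th.-1 / s| p <=
  1 + \sum_(k < d) powR `|b 0 k| p / powR s p.
Proof.
move=> s0; have sum0 : 0 <= \sum_(k < d) powR `|b 0 k| p / powR s p.
  by apply: sumr_ge0 => k _; rewrite divr_ge0 ?powR_ge0.
case: eqP => _; first by rewrite normr1 powR1 lerDl.
by rewrite (le_trans (normr_vcoord_div_powR b _ p0 s0))// lerDr.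
Qed.

Lemma powR_divr (x y : R) : 0 <= x -> 0 <= y -> powR (x / y) p = powR x p / powR y p.
Proof.
move=> x0 y0; rewrite powRM ?invr_ge0//; congr (_ * _).
by rewrite -(powR_inv1 y0) -powRrM mulN1r powRN.
Qed.

(** The coefficient ratio and K^(#offspring) go into [A1], 1/rho(tau) into the lifetime weight and
    the mark weight into the bracket. Being born at a nonnegative time, the particle has a lifetime
    below [T]. *)
Lemma branching_factor_le (u : seq nat) (cv : R) (th : nat) :
  born u w + tau u w < T -> 0 <= born u w -> `|cv| <= Cc (Ix u w) ->
  powR `|cv * (if th == 0%N then 1 else
     vcoord (B u (S u (tau u w) w) w) th.-1 / S u (tau u w) w) /
     (q (Ix u w) * rho (tau u w))| p * K ^+ nchildren u <=
  int_major tau S B rho A1 p T u w.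
Proof.
move=> bT b0 cvb; rewrite /nchildren bT.
have r0 : 0 < rho (tau u w) by have [_ r _] := rho_pos; exact: r.
have ql := q0 (IxL u); set l := Ix u w in ql cvb *.
set th_w := (if th == 0%N then _ else _).
have Cl0 : 0 <= Cc l by exact: le_trans cvb.
have tauT : tau u w < T by rewrite (le_lt_trans _ bT)// lerDr.
have lifeE : life_wt rho p T (tau u w) = (powR (rho (tau u w)) p)^-1.
  by rewrite /life_wt indicE mem_set ?mul1r//= in_itv/= tau0.
have fE : `|cv * th_w / (q l * rho (tau u w))| =
    `|cv| / q l * (`|th_w| / rho (tau u w)).
  by rewrite !normrM normfV normrM (gtr0_norm ql) (gtr0_norm r0) invfM; ring.
rewrite fE powRM ?divr_ge0 ?(ltW ql) ?(ltW r0)//.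
rewrite [in X in _ * X * _]powR_divr ?(ltW r0)// mulrAC.
rewrite /int_major (max_r (tau0 u)) -mulr_sumr lifeE -{1}[X in X + _]mulr1 -mulrDr.
apply: ler_pM.
- by rewrite mulr_ge0 ?powR_ge0// exprn_ge0// (le_trans ler01).
- by rewrite divr_ge0 ?powR_ge0.
- apply: le_trans (A1P (IxL u)); rewrite ler_wpM2r ?exprn_ge0 ?(le_trans ler01)//.
  rewrite ge0_ler_powR ?nnegrE ?(ltW p0) ?divr_ge0 ?(ltW ql)//.
  by rewrite ler_wpM2r ?invr_ge0 ?(ltW ql).
- rewrite mulrC ler_wpM2l ?invr_ge0 ?powR_ge0//.
  apply: mark_weight_le; exact: S0.
Qed.

(** For mark 0 boundedness of [phi] suffices. For another mark the increment of [phi] is at most Lip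
    |b|, and multiplied by |b_j|/s it is at most Lip |b|^2/s, whose p-th power is split over the
    coordinates. *)
Lemma leaf_factor_le (u : seq nat) (x : 'rV[R]_d) (th : nat) :
  0 <= born u w <= T ->
  let s := S u (T - born u w) w in
  powR `|(phi (x + B u s w) - (if th == 0%N then 0 else phi x)) *
     (if th == 0%N then 1 else vcoord (B u s w) th.-1 / s) /
     Fbar rho (T - born u w)| p <=
  leaf_major S B A2 p u (Num.max 0 (T - born u w)) w.
Proof.
move=> /andP[b0 bT] /=; set s := S u (T - born u w) w.
have Tb0 : 0 <= T - born u w by rewrite subr_ge0.
rewrite (max_r Tb0) /leaf_major.
have s0 : 0 <= s by exact: S0.
have T00 : 0 <= T0 by rewrite (le_trans _ TT0)// (le_trans b0).
have F0 : 0 < Fbar rho T0 by exact: Fbar_gt0.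
have FT : Fbar rho T0 <= Fbar rho (T - born u w).
  by apply: Fbar_anti => //; rewrite Tb0/= (le_trans _ TT0)// gerBl.
have Fb0 := lt_le_trans F0 FT.
have Finv : (Fbar rho (T - born u w))^-1 <= (Fbar rho T0)^-1.
  by rewrite lef_pV2 ?posrE.
have sumr0 : 0 <= \sum_(j < d) bm_ratio S B (2 * p) p u j (T - born u w) w w.
  by apply: sumr_ge0 => j _; exact: bm_ratio_ge0.
case: eqP => _.
  rewrite subr0 mulr1 normrM normfV (gtr0_norm Fb0).
  have M0 : 0 <= M by exact: le_trans (phib 0).
  apply: (@le_trans _ _ A2); last by rewrite ler_peMr// lerDl.
  apply: le_trans A2M; rewrite ge0_ler_powR ?nnegrE ?(ltW p0) ?divr_ge0 ?(ltW F0) ?(ltW Fb0)//.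
  by apply: ler_pM => //; rewrite invr_ge0 ltW.
set b := B u s w.
apply: (@le_trans _ _ (powR (Lip / Fbar rho T0 * (\sum_(k < d) b 0 k ^+ 2 / s)) p)).
  have sum0 : 0 <= \sum_(k < d) b 0 k ^+ 2 / s.
    by apply: sumr_ge0 => k _; rewrite divr_ge0 ?sqr_ge0.
  rewrite ge0_ler_powR ?nnegrE ?(ltW p0) ?mulr_ge0 ?invr_ge0 ?(ltW F0)//.
  rewrite !normrM !normfV (gtr0_norm Fb0) (ger0_norm s0).
  have := phiL (x + b) x; rewrite addrAC subrr add0r => phixb.
  rewrite mulrAC; apply: (@le_trans _ _ (Lip * enorm b / Fbar rho T0 *
    (`|vcoord b th.-1| / s))).
    rewrite ler_wpM2r ?divr_ge0// ler_pM ?invr_ge0 ?(ltW Fb0)//.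
  rewrite -mulr_suml [leLHS](_ : _ = Lip / Fbar rho T0 * (enorm b * `|vcoord b th.-1| / s)).
    rewrite ler_wpM2l ?divr_ge0 ?(ltW F0)// ler_wpM2r ?invr_ge0//.
    exact: enorm_vcoord_le.
  by rewrite !mulrA; congr (_ * _); rewrite -!mulrA; congr (_ * _); rewrite [in LHS]mulrCA.
rewrite powRM ?divr_ge0 ?(ltW F0)//; last first.
  by apply: sumr_ge0 => k _; rewrite divr_ge0 ?sqr_ge0.
apply: (@le_trans _ _ (powR (Lip / Fbar rho T0) p *
    (powR d%:R p * \sum_(k < d) powR (b 0 k ^+ 2 / s) p))).
  rewrite ler_wpM2l ?powR_ge0//; apply: powR_sum_le => // k.
  by rewrite divr_ge0 ?sqr_ge0.
rewrite mulrA; apply: ler_pM => //.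
- by rewrite mulr_ge0 ?powR_ge0.
- by apply: sumr_ge0 => k _; exact: powR_ge0.
rewrite -[leLHS]add0r lerD//; apply: ler_sum => k _.
by rewrite powR_sqr_div.
Qed.

(** K times [step] is the sum of the branching and the leaf majorant; the particle uses one of them
    and the other is dropped as nonnegative. *)
Lemma pfactor_le (x : 'rV[R]_d) (i : nat) (u : seq nat) : alive u w ->
  powR `|Defs.pfactor tau Ix S B q rho c phi T t x i w u| p * K ^+ nchildren u <=
  K * step u w w.
Proof.
move=> au; have /andP[b0 bT] := alive_born_itv tT tau0 au.
have K0 : 0 < K by exact: lt_le_trans K1.
rewrite /step au mulrA mulfV ?gt_eqF// mul1r.
have i0 : 0 <= int_major tau S B rho A1 p T u w by exact: int_major_ge0.
have l0 : 0 <= leaf_major S B A2 p u (Num.max 0 (T - born u w)) w.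
  exact: leaf_major_ge0.
rewrite /Defs.pfactor; have := pst_alive_born tau Ix S B T t x i w u.
case: (pst tau Ix S B T t x i w u) => [[[a b] xb] th]/= [_ ->].
case: ifPn => bt.
  rewrite -[leLHS]addr0 lerD//; apply: branching_factor_le => //.
  by apply: cb => //; rewrite addr_ge0//= (le_trans (ltW bt)).
rewrite /nchildren (negbTE bt) expr0 mulr1 -[leLHS]add0r lerD//.
by apply: leaf_factor_le; rewrite b0.
Qed.

(** Every word of the tree is the root, which accounts for the successor, or [rcons u j] with [u] in
    the tree and [j] below the number of children of [u]. *)
Lemma size_tree_le (Tr : seq (seq nat)) : uniq Tr -> (forall u, (u \in Tr) = alive u w) ->
  (size Tr <= (\sum_(u <- Tr) nchildren u).+1)%N.
Proof.
move=> uTr TrE.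
have -> : (\sum_(u <- Tr) nchildren u).+1 = size ([::] ::
    flatten [seq [seq rcons u j | j <- iota 0 (nchildren u)] | u <- Tr]).
  rewrite /= size_flatten /shape -map_comp sumnE big_map; congr _.+1.
  by apply: eq_bigr => u _; rewrite /= size_map size_iota.
apply: uniq_leq_size => // u; rewrite TrE; case/lastP: u => [|u j].
  by rewrite inE eqxx.
rewrite alive_rcons => /and3P[au bu ju]; rewrite inE; apply/orP; right.
apply/flatten_mapP; exists u; first by rewrite TrE.
by apply: map_f; rewrite mem_iota /nchildren bu.
Qed.

Lemma powR_norm_prod (I : Type) (s : seq I) (f : I -> R) :
  powR `|\prod_(i <- s) f i| p = \prod_(i <- s) powR `|f i| p.
Proof.
elim: s => [|i s IH]; first by rewrite !big_nil normr1 powR1.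
by rewrite !big_cons normrM powRM// IH.
Qed.

Lemma prod_pfactor_le (x : 'rV[R]_d) (i : nat) (Tr : seq (seq nat)) :
  uniq Tr -> (forall u, (u \in Tr) = alive u w) ->
  powR `|\prod_(u <- Tr) Defs.pfactor tau Ix S B q rho c phi T t x i w u| p <=
  K * \prod_(u <- Tr) step u w w.
Proof.
move=> uTr TrE; have K0 : 0 < K by exact: lt_le_trans K1.
(* Both sides are multiplied by K^N. The left becomes a product of factors bounded by K times
   [step], which yields K^(size Tr), and size Tr <= N + 1. *)
set N := (\sum_(u <- Tr) nchildren u)%N.
have KN : 0 < K ^+ N by rewrite exprn_gt0.
rewrite powR_norm_prod -(ler_pM2r KN) /N -prodrXr -big_split/=.
have st0 : 0 <= \prod_(u <- Tr) step u w w.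
  by apply: prodr_ge0 => u _; exact: step_ge0.
apply: (@le_trans _ _ (\prod_(u <- Tr) (K * step u w w))).
  rewrite !big_seq; apply: ler_prod => u uTrin; rewrite mulr_ge0 ?powR_ge0//=.
    by apply: pfactor_le; rewrite -TrE.
  by rewrite exprn_ge0 ?ltW.
rewrite big_split/= big_const_seq count_predT iter_mulr_1.
rewrite mulrAC ler_wpM2r// prodrXr -exprS ler_weXn2l//.
exact: size_tree_le.
Qed.

Lemma step_dead u : ~~ alive u w -> step u w w = 1.
Proof. by rewrite /step => /negbTE ->. Qed.

(** Words outside the tree contribute the factor 1, so the product over any finite set containing
    the tree is the product over the tree. *)
Lemma prod_step_eq (Tr U : seq (seq nat)) : uniq Tr -> uniq U -> {subset Tr <= U} ->
  (forall u, (u \in Tr) = alive u w) ->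
  \prod_(u <- U) step u w w = \prod_(u <- Tr) step u w w.
Proof.
move=> uTr uU TU TrE.
rewrite (bigID (alive ^~ w))/= [X in _ * X]big1 ?mulr1; last exact: step_dead.
rewrite -big_filter; apply: perm_big; apply: uniq_perm => //.
  exact: filter_uniq.
by move=> u; rewrite mem_filter -TrE; apply/andb_idr => /TU.
Qed.

End pointwise.

(** * The moment bound *)

Section liminf.
Context {R : realType}.
Local Open Scope ereal_scope.

Lemma limn_einf_le (u : (\bar R)^nat) (a : \bar R) :
  (forall n, u n <= a) -> limn_einf u <= a.
Proof.
move=> ua; rewrite limn_einf_lim; apply: lime_le; first exact: is_cvg_einfs.
apply: nearW => n; apply: le_trans (ua n).
by apply: ereal_inf_lbound; exists n => /=.
Qed.

Lemma limn_einf_ge0 (u : (\bar R)^nat) : (forall n, 0 <= u n) -> 0 <= limn_einf u.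
Proof.
move=> u0; rewrite limn_einf_lim; apply: lime_ge; first exact: is_cvg_einfs.
by apply: nearW => n; apply: le_ereal_inf_tmp => _ [k _ <-].
Qed.

Lemma measurable_fun_limn_einf {d : measure_display} {T : measurableType d}
    (f : (T -> \bar R)^nat) :
  (forall n, measurable_fun setT (f n)) ->
  measurable_fun setT (fun x => limn_einf (f ^~ x)).
Proof.
move=> mf; apply: (emeasurable_fun_cvg (fun n x => einfs (f ^~ x) n)).
  exact: measurable_fun_einfs.
by move=> x _; rewrite limn_einf_lim; exact: is_cvg_einfs.
Qed.

End liminf.

(** An exhaustion of all words by finite lists. Sorting by length puts ancestors before descendants,
    the order in which the steps are integrated. *)
Definition first_words (n : nat) : seq (seq nat) :=
  sort (fun u v : seq nat => (size u <= size v)%N)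
    (undup (pmap (@unpickle (seq nat)) (iota 0 n))).

Lemma first_words_uniq n : uniq (first_words n).
Proof. by rewrite sort_uniq undup_uniq. Qed.

Lemma first_words_sorted n :
  sorted (fun u v : seq nat => (size u <= size v)%N) (first_words n).
Proof. by apply: sort_sorted => u v; exact: leq_total. Qed.

Lemma first_words_exhaust (Tr : seq (seq nat)) :
  exists N, forall n, (N <= n)%N -> {subset Tr <= first_words n}.
Proof.
exists (\max_(u <- Tr) (pickle u).+1)%N => n Nn u uTr.
rewrite mem_sort mem_undup mem_pmap; apply/mapP; exists (pickle u).
  rewrite mem_iota/= add0n; apply: leq_trans Nn.
  exact: (@leq_bigmax_seq _ Tr xpredT (fun u => (pickle u).+1) u).
by rewrite pickleK.
Qed.

Section null_sets.
Context {R : realType} {d0 : measure_display} {Omega : measurableType d0}.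
Variable P : probability Omega R.

Lemma negligible_countable (I : countType) (F : I -> set Omega) :
  (forall i, P.-negligible (F i)) -> P.-negligible (\bigcup_i F i).
Proof.
move=> F0; pose G n := if @unpickle I n is Some i then F i else set0.
apply: (@negligibleS _ _ _ _ (\bigcup_n G n)).
  by move=> w [i _ Fiw]; exists (pickle i) => //; rewrite /G pickleK.
apply: negligible_bigcup => n; rewrite /G.
by case: unpickle => [i|]; [exact: F0|exact: negligible_set0].
Qed.

End null_sets.

Section good_event.
Context {R : realType} {d m : nat} {d0 : measure_display} {Omega : measurableType d0}.
Variable P : probability Omega R.
Variables (tau : seq nat -> Omega -> R) (Ix : seq nat -> Omega -> {ffun 'I_m.+1 -> nat})
  (S : seq nat -> R -> Omega -> R) (B : seq nat -> R -> Omega -> 'rV[R]_d).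
Variables (eta : R -> R) (L : seq {ffun 'I_m.+1 -> nat})
  (q : {ffun 'I_m.+1 -> nat} -> R) (rho : R -> R).
Hypothesis pf : particle_family eta L q rho P tau Ix S B.

Lemma negligible_tau_lt0 v : P.-negligible [set w | tau v w < 0].
Proof.
have [law _ _ _ _] := pf; have [mtau lawP] := law v.
have E : [set w | tau v w < 0] = tau v @^-1` [set` `]-oo, 0[%R].
  by apply/seteqP; split => w /=; rewrite in_itv.
rewrite E; apply/negligibleP.
  by rewrite -[X in measurable X]setTI; exact: mtau.
apply: (eq_trans (lawP _ (measurable_itv _))).
rewrite (_ : _ `&` _ = set0) ?integral_set0//.
apply/seteqP; split => // s [] /=; rewrite !in_itv/= andbT => s0.
by rewrite leNgt s0.
Qed.

Lemma negligible_Ix_notin v : P.-negligible [set w | Ix v w \notin L].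
Proof.
have [_ mIx lawI _ _] := pf.
apply: (@negligibleS _ _ _ _
  (\bigcup_(l : {ffun 'I_m.+1 -> nat}) [set w | (Ix v w == l) && (l \notin L)])).
  by move=> w /= wL; exists (Ix v w) => //=; rewrite eqxx.
apply: negligible_countable => l.
have [lL|lL] := boolP (l \in L).
  rewrite (_ : [set w | _] = set0); first exact: negligible_set0.
  by apply/seteqP; split => // w /=; rewrite andbF.
have E : [set w | (Ix v w == l) && true] = Ix v @^-1` [set l].
  by apply/seteqP; split => w /=; rewrite andbT; [move/eqP|move=> ->; rewrite eqxx].
rewrite E; apply/negligibleP; last first.
  by apply: (eq_trans (lawI v l)); rewrite (negbTE lL).
(* Measurability of the index is assumed coordinate by coordinate, so the event is written through
   its coordinates. *)
have -> : Ix v @^-1` [set l] =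
    \bigcap_(r in [set: 'I_m.+1]) ((fun w => (Ix v w r)%:R : R) @^-1` [set (l r)%:R]).
  apply/seteqP; split => w /=; first by move=> Ewl r _ /=; rewrite Ewl.
  move=> H; apply/ffunP => r; apply/eqP; rewrite -(@eqr_nat R); apply/eqP.
  exact: H.
apply: fin_bigcap_measurable; first exact: finite_finset.
by move=> r _; rewrite -[X in measurable X]setTI; exact: mIx.
Qed.

Lemma null_bad_event : exists N : set Omega, [/\ measurable N, P N = 0%E &
  forall w, ~ N w -> (forall v, 0 <= tau v w) /\ (forall v, Ix v w \in L)].
Proof.
have [|N [mN N0 bN]] := @negligible_countable _ _ _ P (seq nat)
    (fun v => [set w | tau v w < 0] `|` [set w | Ix v w \notin L]).
  move=> v; apply: negligibleU; first exact: negligible_tau_lt0.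
  exact: negligible_Ix_notin.
exists N; split => // w Nw; split => v.
  rewrite leNgt; apply/negP => tv; apply/Nw/bN.
  by exists v => //; left.
by apply: contrapT => /negP tv; apply/Nw/bN; exists v => //; right.
Qed.

End good_event.

Section sup_moment.
Context {R : realType} {d m : nat} {d0 : measure_display} {Omega : measurableType d0}.
Variable P : probability Omega R.
Variables (tau : seq nat -> Omega -> R) (Ix : seq nat -> Omega -> {ffun 'I_m.+1 -> nat})
  (S : seq nat -> R -> Omega -> R) (B : seq nat -> R -> Omega -> 'rV[R]_d).
Variables (eta : R -> R) (L : seq {ffun 'I_m.+1 -> nat})
  (q : {ffun 'I_m.+1 -> nat} -> R) (rho : R -> R).
Hypothesis pf : particle_family eta L q rho P tau Ix S B.
Hypothesis rho_pos : pos_density rho.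
Variables (c : {ffun 'I_m.+1 -> nat} -> R -> 'rV[R]_d -> R) (phi : 'rV[R]_d -> R).
Variables (T0 T t p K A1 A2 M Lip : R) (Cc : {ffun 'I_m.+1 -> nat} -> R).
Hypotheses (p0 : 0 < p) (tT : 0 <= t <= T) (TT0 : T <= T0).
Hypothesis q0 : forall l, l \in L -> 0 < q l.
Hypothesis cb : forall l s x, l \in L -> 0 <= s <= T0 -> `|c l s x| <= Cc l.
Hypothesis phib : forall x, `|phi x| <= M.
Hypothesis phiL : forall x y, `|phi x - phi y| <= Lip * enorm (x - y).
Hypotheses (A1_ge0 : 0 <= A1) (A2_ge0 : 0 <= A2) (K1 : 1 <= K).
Hypothesis A1P : forall l, l \in L -> powR (Cc l / q l) p * K ^+ lsize l <= A1.
Hypothesis A2M : powR (M / Fbar rho T0) p <= A2.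
Hypothesis A2L : powR (Lip / Fbar rho T0) p * powR d%:R p <= A2.
Hypothesis Lip0 : 0 <= Lip.
Hypothesis int_le : forall u, (\int[P]_w (int_major tau S B rho A1 p T u w)%:E <= (K / 2)%:E)%E.
Hypothesis leaf_le : forall u s, 0 <= s ->
  (\int[P]_w (leaf_major S B A2 p u s w)%:E <= (K / 2)%:E)%E.

Let step := step tau Ix S B rho A1 A2 p T t K.
Let approx (n : nat) (w : Omega) : \bar R :=
  (\prod_(u <- first_words n) step u w w)%:E.
Let K0 : 0 < K. Proof. exact: lt_le_trans K1. Qed.

Let approx_ge0 n w : (0 <= approx n w)%E.
Proof. by rewrite lee_fin; apply: prodr_ge0 => u _; exact: step_ge0. Qed.

Let sup_Hphi i w : \bar R := ereal_sup
  [set (powR `|Hphi tau Ix S B q rho c phi T t x i w| p)%:E | x in [set: 'rV[R]_d]].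

Let sup_Hphi_ge0 i w : (0 <= sup_Hphi i w)%E.
Proof.
apply: (@le_trans _ _ (powR `|Hphi tau Ix S B q rho c phi T t 0 i w| p)%:E).
  by rewrite lee_fin powR_ge0.
by apply: ereal_sup_ubound; exists 0.
Qed.

(** For a finite tree the approximations are eventually constant, equal to the product over the
    tree, and so is their lower limit. The added 1 covers infinite trees. *)
Lemma sup_Hphi_le i w : (forall v, 0 <= tau v w) -> (forall v, Ix v w \in L) ->
  (sup_Hphi i w <= K%:E * limn_einf (approx ^~ w) + 1)%E.
Proof.
move=> tau0 IxL; apply: ge_ereal_sup => _ [x _ <-].
have S0 u s : 0 <= s -> 0 <= S u s w by exact: sub_ge0 pf u s w.
have lim0 : (0 <= limn_einf (approx ^~ w))%E by apply: limn_einf_ge0.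
rewrite /Hphi; set A := in_tree _ _ _ _ _ _ _ _ _.
have AE u : A u = alive tau Ix S B T t u w :> Prop.
  by rewrite /A /in_tree /= pst_alive_born.
have [finA|infA] := pselect (finite_set A); last first.
  (* An infinite tree contributes an empty product. *)
  have -> : fset_set A = finmap.fset0.
    by rewrite /fset_set; case: pselect.
  have -> : finmap.enum_fset (@finmap.fset0 (seq nat)) = [::].
    by apply/eqP; rewrite -size_eq0; apply/eqP; exact: finmap.cardfs0.
  by rewrite big_nil normr1 powR1 leeDr// mule_ge0// lee_fin ltW.
set Tr := finmap.enum_fset (fset_set A).
have uTr : uniq Tr by exact: finmap.fset_uniq.
have TrE u : (u \in Tr) = alive tau Ix S B T t u w.
  have -> : (u \in Tr) = (u \in A) by exact: (in_fset_set finA u).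
  by apply/idP/idP => [/set_mem|?]; [rewrite AE|apply: mem_set; rewrite AE].
have [N HN] := first_words_exhaust Tr.
have -> : limn_einf (approx ^~ w) = (\prod_(u <- Tr) step u w w)%:E.
  have [] // := @cvg_limn_einf_sup R (approx ^~ w) (\prod_(u <- Tr) step u w w)%:E.
  apply: cvg_near_cst; exists N => // n /= Nn; congr (_%:E).
  by apply: prod_step_eq => //; [exact: first_words_uniq|exact: HN].
rewrite -EFinM -EFinD lee_fin.
by rewrite (le_trans (prod_pfactor_le rho_pos p0 tT TT0 q0 cb phib phiL A1_ge0 A2_ge0 K1
  A1P A2M A2L Lip0 tau0 IxL S0 x i uTr TrE))// lerDl.
Qed.

Lemma integral_sup_Hphi_lt_pinfty i : (\int[P]_w sup_Hphi i w < +oo)%E.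
Proof.
have [N [mN N0 good]] := null_bad_event pf.
pose h w := (K%:E * limn_einf (approx ^~ w) + 1)%E.
have mapprox n : measurable_fun setT (approx n).
  exact: (measurable_prod_step pf rho_pos).
have ml : measurable_fun setT (fun w => limn_einf (approx ^~ w)).
  exact: measurable_fun_limn_einf.
have lim0 w : (0 <= limn_einf (approx ^~ w))%E by apply: limn_einf_ge0.
have mh : measurable_fun setT h by apply: emeasurable_funD => //; exact: emeasurable_funM.
have h0 w : (0 <= h w)%E by rewrite adde_ge0// mule_ge0// lee_fin ltW.
(* A measurable function that dominates the supremum everywhere: the value +oo on the null set [N]
   does not affect its integral. *)
pose g w := if w \in N then +oo%E else h w.
have g0 w : (0 <= g w)%E by rewrite /g; case: ifPn => // _; rewrite leey.
have mg : measurable_fun setT g.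
  apply: measurable_fun_ifT => //.
  apply: (measurable_fun_bool true) => //.
  rewrite setTI (_ : _ @^-1` _ = N)//.
  by apply/seteqP; split => w /=; [move/set_mem|move/mem_set].
apply: (@le_lt_trans _ _ (\int[P]_w g w)%E).
  apply: le_integral_nonmeasurable => w _; first exact: sup_Hphi_ge0.
  rewrite /g; case: ifPn => [_|]; first by rewrite leey.
  by rewrite notin_setE => /good[tau0 IxL]; exact: sup_Hphi_le.
rewrite (@ge0_negligible_integral _ _ _ P setT N)//.
apply: (@le_lt_trans _ _ (\int[P]_w h w)%E).
  rewrite integral_mkcond; apply: le_integral_nonmeasurable => w _.
    by rewrite /patch; case: ifPn.
  rewrite /patch; case: ifPn => // /set_mem /= [_ Nw].
  by rewrite /g memNset.
rewrite ge0_integralD//; last 2 first.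
- by move=> w _; rewrite mule_ge0// lee_fin ltW.
- exact: emeasurable_funM.
rewrite integral_cst//= probability_setT mule1.
rewrite ge0_integralZl_EFin ?(ltW K0)//.
apply: (@le_lt_trans _ _ (K%:E * 1 + 1)%E); last by rewrite mule1 -EFinD ltry.
apply: leeD => //; rewrite lee_wpmul2l ?lee_fin ?(ltW K0)//.
apply: le_trans (fatou P measurableT mapprox (fun n w _ => approx_ge0 n w)) _.
apply: limn_einf_le => n.
apply: (expect_prod_step_le1 pf) => //.
- exact: first_words_uniq.
- exact: first_words_sorted.
Qed.

End sup_moment.

(** * Choice of the constants and of the horizon *)

Lemma cond_etaE {R : realType} (p T : R) (rho eta : R -> R) : bernstein eta ->
  cond_eta p T rho eta =
  (\int[@lebesgue_measure R]_(s in [set` `[0%R, T]%R])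
    (rho_wt rho p s * laplace_int eta p s) < +oo)%E.
Proof.
move=> eta_bern; rewrite /cond_eta; congr (is_true (_ < _)%E).
apply: eq_integral => s _; rewrite /laplace_int /rho_wt.
rewrite -ge0_integralZl_EFin ?invr_ge0 ?powR_ge0//.
- by apply: eq_integral => l _; rewrite -EFinM; congr (_%:E); rewrite mulrA (mulrC (expR _)).
- by move=> l _; rewrite lee_fin mulr_ge0 ?expR_ge0 ?powR_ge0.
- apply/measurable_EFinP; apply: measurable_funM.
    apply: measurableT_comp => //; apply: measurableT_comp => //.
    by apply: measurable_funM => //; exact: bernstein_measurable.
  by apply: measurable_funTS; exact: measurable_powR.
Qed.

Lemma small_time {R : realType} (p T0 C D : R) (rho eta : R -> R) :
  bernstein eta -> pos_density rho -> 0 < T0 -> 0 <= C -> 0 < D ->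
  cond_rho p T0 rho -> cond_eta p T0 rho eta ->
  exists T, [/\ 0 < T, T <= T0 &
    (\int[@lebesgue_measure R]_(s in [set` `[0%R, T]%R]) rho_wt rho p s + C%:E *
     \int[@lebesgue_measure R]_(s in [set` `[0%R, T]%R])
       (rho_wt rho p s * laplace_int eta p s) <= D%:E)%E].
Proof.
move=> eta_bern rho_pos T00 C0 D0 crho; rewrite cond_etaE// => ceta.
have mr := measurable_rho_wt rho_pos p.
have ml := measurable_laplace_int p eta_bern.
have r0 s : (0 <= rho_wt rho p s)%E by exact: rho_wt_ge0.
have rl0 s : (0 <= rho_wt rho p s * laplace_int eta p s)%E.
  by rewrite mule_ge0// laplace_int_ge0.
have C1 : 0 < 1 + C by rewrite ltr_pwDl.
(* Chosen so that e + C e = D. *)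
pose e := D / (1 + C); have e0 : 0 < e by rewrite divr_gt0.
have [T1 [T10 T1T I1]] := small_initial_integral T00 e0 mr r0 crho.
have [T2 [T20 T2T I2]] := small_initial_integral T00 e0
  (emeasurable_funM mr ml) rl0 ceta.
have mono (f : R -> \bar R) (T T' : R) : (forall s, 0 <= f s)%E -> T <= T' ->
    (\int[@lebesgue_measure R]_(s in [set` `[0%R, T]%R]) f s <=
     \int[@lebesgue_measure R]_(s in [set` `[0%R, T']%R]) f s)%E.
  move=> f0 TT'; rewrite integral_mkcond [leRHS]integral_mkcond.
  apply: le_integral_nonmeasurable => s _; rewrite /patch; case: ifPn => // [|_].
    rewrite inE/= in_itv/= => /andP[s0 sT].
    by rewrite ifT// inE/= in_itv/= s0 (le_trans sT).
  by case: ifPn.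
exists (Num.min T1 T2); split.
- by rewrite lt_min T10.
- by rewrite ge_min T1T.
apply: (@le_trans _ _ (e%:E + C%:E * e%:E)%E).
  apply: leeD.
    by apply: le_trans I1; apply: mono => //; rewrite ge_min lexx.
  rewrite lee_wpmul2l ?lee_fin//; apply: le_trans I2; apply: mono => //.
  by rewrite ge_min lexx orbT.
rewrite -EFinM -EFinD lee_fin le_eqVlt; apply/orP; left; apply/eqP.
by rewrite /e; field; rewrite gt_eqF.
Qed.

Lemma finite_upper_bound {R : realType} (I : eqType) (s : seq I) (f : I -> R) :
  exists2 A, 0 <= A & forall i, i \in s -> f i <= A.
Proof.
exists (\sum_(i <- s) `|f i|) => [|i si]; first by apply: sumr_ge0.
rewrite (perm_big _ (perm_to_rem si)) big_cons/= (le_trans (ler_norm _))// lerDl.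
exact: sumr_ge0.
Qed.

Lemma exists_small_time_moment (R : realType) (d : nat) (eta : R -> R) (m : nat)
    (L : seq {ffun 'I_m.+1 -> nat}) (q : {ffun 'I_m.+1 -> nat} -> R)
    (rho : R -> R) (T0 : R) (c : {ffun 'I_m.+1 -> nat} -> R -> 'rV[R]_d -> R)
    (phi : 'rV[R]_d -> R) (p : R) :
  bernstein eta -> (forall l, l \in L -> 0 < q l) -> pos_density rho -> 0 < T0 ->
  (forall l, l \in L -> exists M : R,
     forall t x, 0 <= t <= T0 -> `|c l t x| <= M) ->
  (exists M : R, forall x, `|phi x| <= M) ->
  (exists Lip : R, forall x y, `|phi x - phi y| <= Lip * enorm (x - y)) ->
  1 <= p -> cond_rho p T0 rho -> cond_eta p T0 rho eta ->
  exists T : R, 0 < T <= T0 /\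
    forall (d0 : measure_display) (Omega : measurableType d0) (P : probability Omega R)
      (tau : seq nat -> Omega -> R) (Ix : seq nat -> Omega -> {ffun 'I_m.+1 -> nat})
      (S : seq nat -> R -> Omega -> R) (B : seq nat -> R -> Omega -> 'rV[R]_d),
      particle_family eta L q rho P tau Ix S B ->
      forall (t : R) (i : nat), 0 <= t <= T ->
        (\int[P]_w ereal_sup
            [set (powR `|Hphi tau Ix S B q rho c phi T t x i w| p)%:E | x in [set: 'rV[R]_d]]
         < +oo)%E.
Proof.
move=> eta_bern q0 rho_pos T00 cbd [M phib] [Lip' phiL'] p1 crho ceta.
have p0 : 0 < p by exact: lt_le_trans p1.
have [Cc cb] : exists Cc, forall l s x, l \in L -> 0 <= s <= T0 -> `|c l s x| <= Cc l.
  have /choice[Cc HCc] : forall l, exists Ml : R, l \in L ->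
      forall t x, 0 <= t <= T0 -> `|c l t x| <= Ml.
    move=> l; have [lL|_] := boolP (l \in L); last by exists 0.
    by have [Ml HMl] := cbd _ lL; exists Ml.
  by exists Cc => l s x lL sT; exact: HCc.
pose Lip := `|Lip'|.
have phiL x y : `|phi x - phi y| <= Lip * enorm (x - y).
  by apply: (le_trans (phiL' x y)); rewrite ler_wpM2r ?sqrtr_ge0// ler_norm.
have [C1 C10 HC1] := gaussian_abs_moment (ltW p0).
have p20 : 0 <= 2 * p by rewrite mulr_ge0 ?ltW.
have [C2 C20 HC2] := gaussian_abs_moment p20.
have [Cl Cl0 HCl] := powR_le_laplace p0.
pose a := powR (M / Fbar rho T0) p; pose b := powR (Lip / Fbar rho T0) p * powR d%:R p.
have a0 : 0 <= a by exact: powR_ge0.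
have b0 : 0 <= b by rewrite mulr_ge0 ?powR_ge0.
pose A2 := a + b; have A20 : 0 <= A2 by exact: addr_ge0.
pose Cd := A2 * (1 + d%:R * C2).
have Cd0 : 0 <= Cd by rewrite mulr_ge0// addr_ge0// mulr_ge0// ltW.
(* The leaf mean is at most Cd <= K/2, and the summand 1 ensures K >= 1. *)
pose K := 1 + 2 * Cd.
have K1 : 1 <= K by rewrite lerDl mulr_ge0.
have K0 : 0 < K by exact: lt_le_trans K1.
have [A1 A10 HA1] := finite_upper_bound L
  (fun l => powR (Cc l / q l) p * K ^+ lsize l).
(* The target for the time integrals: multiplied by [A1] it stays below K/2. The added 1 avoids
   dividing by 0. *)
have D0 : 0 < K / 2 / (A1 + 1) by rewrite !divr_gt0// ltr_wpDl.
have C0 : 0 <= d%:R * (C1 * Cl) by rewrite !mulr_ge0// ltW.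
have [T [Tpos TT0 IT]] := small_time eta_bern rho_pos T00 C0 D0 crho ceta.
exists T; split; first by rewrite Tpos.
move=> d0 Omega P tau Ix S B pf t i tT.
apply: (integral_sup_Hphi_lt_pinfty pf rho_pos p0 tT TT0 q0 cb phib phiL A10 A20 K1 HA1) => //.
- by rewrite -[leLHS]addr0 lerD.
- by rewrite -[leLHS]add0r lerD.
- exact: normr_ge0.
- move=> u; apply: (le_trans (expect_int_major (C := C1 * Cl) rho_pos pf eta_bern T A10 _ _)).
  + by rewrite mulr_ge0 ?ltW.
  + move=> j s s0.
    apply: (integral_int_ratio pf) => //; try exact: ltW.
    by move=> v X v0 mX lawX; exact: HC1.
  + apply: (@le_trans _ _ (A1%:E * (K / 2 / (A1 + 1))%:E)%E).
      by rewrite lee_wpmul2l ?lee_fin.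
    rewrite -EFinM lee_fin mulrCA -[leRHS]mulr1 ler_wpM2l ?divr_ge0 ?(ltW K0)//.
    by rewrite ler_pdivrMr ?mul1r ?lerDl// ltr_wpDl.
- move=> u s s0.
  apply: (le_trans (expect_leaf_major pf u A20 p0 (ltW C20) s0 _)).
    by move=> v X v0 mX lawX; exact: HC2.
  by rewrite lee_fin /K -/Cd; lra.
Qed.

(** * The case p = 1 *)

Section inverse_square_root.
Context {R : realType}.
Local Notation leb := (@lebesgue_measure R).

Lemma integral_powR_half_itv (a b : R) : 0 < a -> a < b ->
  (\int[leb]_(x in [set` `[a, b]%R]) (2^-1 * powR x (2^-1 - 1))%:E <=
   (powR b 2^-1)%:E)%E.
Proof.
move=> a0 ab.
have cts (r x : R) : 0 < x -> {for x, continuous (fun x => powR x r)}.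
  move=> x0; apply: differentiable_continuous; apply/derivable1_diffP.
  by apply: derivable_powR; rewrite in_itv/= x0.
rewrite (@continuous_FTC2 _ _ (fun x => powR x 2^-1))//.
- by rewrite -EFinB lee_fin gerBl powR_ge0.
- apply: continuous_in_subspaceT => x; rewrite inE/= in_itv/= => /andP[ax _].
  by apply: cvgM; [exact: cvg_cst|apply: cts; exact: lt_le_trans ax].
- split.
  + move=> x; rewrite in_itv/= => /andP[ax _].
    by apply: derivable_powR; rewrite in_itv/= (lt_trans a0).
  + by apply: cvg_at_right_filter; exact: cts.
  + by apply: cvg_at_left_filter; apply: cts; exact: lt_trans ab.
- move=> x; rewrite in_itv/= => /andP[ax _].
  by rewrite powR_derive1// in_itv/= (lt_trans a0).
Qed.

(** The integrand is singular at 0. The fundamental theorem of calculus is applied on [b/(n+2), b],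
    and these intervals exhaust ]0, b]; the offset 2 makes each of them nondegenerate. *)
Lemma integral_powR_half (b : R) : 0 < b ->
  (\int[leb]_(x in [set` `]0%R, b]%R]) (2^-1 * powR x (2^-1 - 1))%:E <=
   (powR b 2^-1)%:E)%E.
Proof.
move=> b0; set f := fun x : R => (2^-1 * powR x (2^-1 - 1))%:E.
have f0 x : (0 <= f x)%E by rewrite lee_fin mulr_ge0 ?powR_ge0.
have mf (D : set R) : measurable_fun D f.
  apply/measurable_EFinP; apply: measurable_funM => //.
  by apply: measurable_funTS; exact: measurable_powR.
pose t n : R := b / n.+2%:R.
have t0 n : 0 < t n by rewrite divr_gt0.
have tb n : t n < b by rewrite ltr_pdivrMr// ltr_pMr// ltr1n.
have nd : {homo (fun n => [set` `[t n, b]%R] : set R) : n k / (n <= k)%N >-> (n <= k)%O}.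
  move=> n k nk; apply/subsetPset => x /=; rewrite !in_itv/= => /andP[tx ->].
  by rewrite andbT (le_trans _ tx)// ler_pM2l// lef_pV2 ?posrE// ler_nat !ltnS.
have /= cv := @ge0_nondecreasing_set_cvg_integral _ (measurableTypeR R) R
  (fun n => [set` `[t n, b]%R]) f leb nd (fun=> measurable_itv _)
  (fun i => mf _) (fun i x _ => f0 x).
have <- : \bigcup_n [set` `[t n, b]%R] = [set` `]0%R, b]%R] :> set R.
  apply/seteqP; split => x.
    by move=> [n _ /=]; rewrite !in_itv/= => /andP[tx ->]; rewrite (lt_le_trans _ tx).
  rewrite /= in_itv/= => /andP[x0 xb]; exists (Num.truncn (b / x)) => //=.
  rewrite in_itv/= xb andbT /t ler_pdivrMr// mulrC -ler_pdivrMr// ltW//.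
  have /andP[_ /lt_le_trans] := truncn_itv (ltW (divr_gt0 b0 x0)); apply.
  by rewrite ler_nat.
rewrite -(cvg_lim _ cv)//; apply: lime_le; first by apply/cvg_ex; eexists; exact: cv.
by apply: nearW => n; exact: integral_powR_half_itv.
Qed.

(** The integrand is 1/a times the exponential density of rate [a], of total mass 1. *)
Lemma integral_expR_itv_le (T a : R) : 0 < a ->
  (\int[leb]_(s in [set` `[0%R, T]%R]) (expR (- (s * a)))%:E <= (a^-1)%:E)%E.
Proof.
move=> a0; have ai0 : 0 <= a^-1 by rewrite invr_ge0 ltW.
apply: (@le_trans _ _ (\int[leb]_s ((a^-1)%:E * (exponential_pdf a s)%:E))%E).
  rewrite integral_mkcond; apply: le_integral_nonmeasurable => s _.
    by rewrite /patch; case: ifPn => // _; rewrite lee_fin expR_ge0.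
  rewrite /patch; case: ifPn => [|_].
    rewrite inE/= in_itv/= => /andP[s0 _].
    rewrite exponential_pdfE// -EFinM lee_fin mulrA mulVf ?gt_eqF// mul1r.
    by rewrite mulNr mulrC.
  by rewrite -EFinM lee_fin mulr_ge0// exponential_pdf_ge0// ltW.
rewrite ge0_integralZl_EFin//.
- by rewrite integral_exponential_pdf// mule1.
- by move=> s _; rewrite lee_fin exponential_pdf_ge0// ltW.
- by apply/measurable_EFinP; exact: measurable_exponential_pdf.
Qed.

End inverse_square_root.

(** After Tonelli the inner integral over s of exp(-s eta) is at most both |T| and 1/eta. The first
    bound is used up to [l0], where lam^(-1/2) is integrable, and the second beyond [l0], where it
    is the hypothesis [cond_p1]. *)
Lemma laplace_int_locally_integrable {R : realType} (eta : R -> R) (T : R) :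
  bernstein eta -> cond_p1 eta ->
  (\int[@lebesgue_measure R]_(s in [set` `[0%R, T]%R]) laplace_int eta 1 s < +oo)%E.
Proof.
move=> eta_bern [l0 [l00 tail_fin]].
set q : R := 2^-1 - 1.
have qE : 1 / 2 - 1 = q by rewrite div1r.
pose f (z : R * measurableTypeR R) : \bar R :=
  (laplace_integrand eta 1 z * (\1_([set` `[0, T]%R] : set R) z.1)%:E)%E.
have f0 z : (0 <= f z)%E.
  by rewrite mule_ge0 ?lee_fin// !mulr_ge0 ?expR_ge0 ?powR_ge0.
have mf : measurable_fun setT f.
  apply: emeasurable_funM; first exact: measurable_laplace_integrand.
  apply/measurable_EFinP.
  exact: (measurableT_comp (measurable_indic (measurable_itv _)) measurable_fst).
pose G (l : R) : \bar R := (\int[@lebesgue_measure R]_s f (s, l))%E.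
have G0 l : (0 <= G l)%E by exact: integral_ge0.
have mG : measurable_fun setT G.
  exact: (@measurable_fun_fubini_tonelli_G _ _ (measurableTypeR R) (measurableTypeR R) R
    (@lebesgue_measure R) f mf f0).
have -> : (\int[@lebesgue_measure R]_(s in [set` `[0%R, T]%R]) laplace_int eta 1 s =
    \int[@lebesgue_measure R]_l G l)%E.
  rewrite -(@fubini_tonelli _ _ (measurableTypeR R) (measurableTypeR R) R
    (@lebesgue_measure R) (@lebesgue_measure R) f mf f0) integral_mkcond.
  apply: eq_integral => s _; rewrite /patch; case: ifPn => sT; rewrite /f/= indicE.
    by rewrite sT laplace_intE; apply: eq_integral => l _; rewrite mule1.
  rewrite (negbTE sT); under eq_integral do rewrite mule0.
  by rewrite integral0.
have GE l : 0 < l -> (G l = \int[@lebesgue_measure R]_(s in [set` `[0%R, T]%R])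
    ((powR l q)%:E * (expR (- (s * eta l)))%:E))%E.
  move=> l_gt0; have lp : l \in ([set` `]0, +oo[%R] : set R) by rewrite inE/= in_itv/= l_gt0.
  rewrite [RHS]integral_mkcond; apply: eq_integral => s _.
  rewrite /f /laplace_integrand /patch/= lp !indicE lp mulr1 qE.
  by case: ifPn => sT; rewrite ?mule0// mule1 -EFinM mulrC.
have Gneg l : l <= 0 -> G l = 0%E.
  move=> ln; have fl s : f (s, l) = 0%E.
    rewrite /f /laplace_integrand/= [\1_(_) l]indicE memNset ?mulr0 ?mul0e//.
    by rewrite /= in_itv/= andbT; apply/negP; rewrite -leNgt.
  by rewrite /G; under eq_integral do rewrite fl; rewrite integral0.
have Gfac l : 0 < l -> (G l = (powR l q)%:E *
    \int[@lebesgue_measure R]_(s in [set` `[0%R, T]%R]) (expR (- (s * eta l)))%:E)%E.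
  move=> l_gt0; rewrite GE// ge0_integralZl_EFin ?powR_ge0//.
  apply/measurable_EFinP; apply: measurableT_comp => //; apply: measurableT_comp => //.
  exact: measurable_funM.
have eta0 l : 0 < l -> 0 <= eta l by case: eta_bern => + _ _; exact.
(* Where [eta] vanishes the extended inverse is +oo and the bound is trivial. *)
have Gtail l : 0 < l -> (G l <= ((eta l * Num.sqrt l)%:E)^-1)%E.
  move=> l_gt0; have := eta0 _ l_gt0; rewrite le_eqVlt => /orP[/eqP <-|el].
    by rewrite mul0r inve0 leey.
  have sl : 0 < Num.sqrt l by rewrite sqrtr_gt0.
  rewrite Gfac// inver gt_eqF ?mulr_gt0// invfM EFinM muleC.
  apply: lee_pmul; rewrite ?integral_ge0 ?lee_fin ?powR_ge0//.
  - exact: integral_expR_itv_le.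
  - rewrite /q powRB ?(gt_eqF l_gt0) ?implybT// powR12_sqrt ?(ltW l_gt0)// powRr1 ?(ltW l_gt0)//.
    rewrite -[X in _ / X](sqr_sqrtr (ltW l_gt0)) expr2 invfM mulrA mulfV ?gt_eqF//.
    by rewrite mul1r.
(* The factors 2 and 1/2 put the integrand into the form of the derivative of the square root; the
   absolute value admits any sign of [T]. *)
have Ghead l : 0 < l -> (G l <= (2 * `|T|)%:E * (2^-1 * powR l q)%:E)%E.
  move=> l_gt0; rewrite Gfac//.
  apply: (@le_trans _ _ ((powR l q)%:E * `|T|%:E)%E); last first.
    by rewrite -!EFinM lee_fin le_eqVlt; apply/orP; left; apply/eqP; field.
  rewrite lee_wpmul2l ?lee_fin ?powR_ge0//.
  apply: (@le_trans _ _ (\int[@lebesgue_measure R]_(s in [set` `[0%R, T]%R]) cst 1%E s)%E).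
    apply: le_integral_nonmeasurable => s; first by rewrite lee_fin expR_ge0.
    rewrite /= in_itv/= => /andP[s0 _]; rewrite lee_fin -expR0 ler_expR oppr_le0.
    by rewrite mulr_ge0// eta0.
  rewrite integral_cst//= mul1e lebesgue_measure_itv/= lte_fin.
  by case: ifPn => [_|_]; rewrite -?EFinB ?subr0 lee_fin ?ler_norm.
pose Dl : set R := [set` `]-oo, l0]%R]; pose Dr : set R := [set` `]l0, +oo[%R].
have -> : (\int[@lebesgue_measure R]_l G l =
    \int[@lebesgue_measure R]_(l in Dl) G l + \int[@lebesgue_measure R]_(l in Dr) G l)%E.
  rewrite -ge0_integral_setU//=.
  - congr (integral _ _ _); apply/seteqP; split => // l _.
    by rewrite /Dl /Dr/= !in_itv/= andbT; have [|] := leP l l0; [left|right].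
  - exact: measurable_itv.
  - exact: measurable_itv.
  - exact: measurable_funS mG.
  - apply/disj_setPLR => l; rewrite /Dl /Dr/= !in_itv/= andbT => ll0.
    by apply/negP; rewrite -leNgt.
apply: lte_add_pinfty.
  apply: (@le_lt_trans _ _ (\int[@lebesgue_measure R]_(l in [set` `]0%R, l0]%R])
     ((2 * `|T|)%:E * (2^-1 * powR l q)%:E))%E).
    rewrite integral_mkcond [leRHS]integral_mkcond.
    apply: le_integral_nonmeasurable => l _; rewrite /patch.
      by case: ifPn.
    case: ifPn => lD; last first.
      case: ifPn => // _; by rewrite mule_ge0 ?lee_fin ?mulr_ge0 ?powR_ge0.
    have [lneg|lpos] := leP l 0.
      rewrite Gneg//; case: ifPn => // _.
      by rewrite mule_ge0 ?lee_fin ?mulr_ge0 ?powR_ge0.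
    rewrite ifT ?Ghead//; move: lD; rewrite /Dl !inE/= !in_itv/= => lD.
    by rewrite lpos.
  rewrite ge0_integralZl_EFin ?mulr_ge0//.
  - rewrite lte_mul_pinfty ?lee_fin ?mulr_ge0//.
    by rewrite (le_lt_trans (integral_powR_half l00))// ltry.
  - by move=> l _; rewrite lee_fin mulr_ge0 ?powR_ge0.
  - apply/measurable_EFinP; apply: measurable_funM => //.
    by apply: measurable_funTS; exact: measurable_powR.
apply: le_lt_trans tail_fin.
rewrite integral_mkcond [leRHS]integral_mkcond.
apply: le_integral_nonmeasurable => l _; rewrite /patch; first by case: ifPn.
have inv0 : l0 <= l -> (0 <= ((eta l * Num.sqrt l)%:E)^-1)%E.
  move=> ll; rewrite inve_ge0 lee_fin mulr_ge0 ?sqrtr_ge0// eta0//.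
  exact: lt_le_trans ll.
case: ifPn => lD.
  move: lD; rewrite inE /Dr/= in_itv/= andbT => lD.
  by rewrite ifT ?Gtail ?(lt_trans l00)// inE/= in_itv/= ltW.
by case: ifPn => //; rewrite inE/= in_itv/= andbT; exact: inv0.
Qed.

(** For p = 1 the weight rho^(1-p) is identically 1, so [rho] disappears from both conditions. *)
Lemma cond_p1_sufficient (R : realType) (eta : R -> R) :
  bernstein eta -> cond_p1 eta ->
  forall (rho : R -> R) (T : R), cond_rho 1 T rho /\ cond_eta 1 T rho eta.
Proof.
move=> eta_bern ceta rho T.
have wt1 s : rho_wt rho 1 s = 1%E by rewrite /rho_wt subrr powRr0 invr1.
split.
  rewrite /cond_rho.
  under eq_integral => s _ do rewrite -/(rho_wt rho 1 s) wt1.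
  rewrite integral_cst//= mul1e lebesgue_measure_itv/=.
  by case: ifPn => // _; rewrite -EFinB ltry.
rewrite cond_etaE//; under eq_integral do rewrite wt1 mul1e.
exact: laplace_int_locally_integrable.
Qed.

Unset Implicit Arguments.

Theorem theorem4p1 :
  (* Main claim *)
  (forall (R : realType) (d : nat), (0 < d)%N ->
   forall (eta : R -> R), bernstein eta -> eta x @[x --> 0^'+] --> 0 ->
   forall (m : nat), (m <= d)%N ->
   forall (L : seq {ffun 'I_m.+1 -> nat}) (q : {ffun 'I_m.+1 -> nat} -> R),
     uniq L -> (forall l, l \in L -> 0 < q l) -> \sum_(l <- L) q l = 1 ->
   forall (rho : R -> R), pos_density rho ->
   forall (T0 : R), 0 < T0 ->
   forall (c : {ffun 'I_m.+1 -> nat} -> R -> 'rV[R]_d -> R),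
     (forall l, l \in L ->
        borel_mble [set tx : R * 'rV[R]_d | 0 <= tx.1 <= T0] (fun tx => c l tx.1 tx.2)) ->
     (forall l, l \in L -> exists M : R,
        forall t x, 0 <= t <= T0 -> `|c l t x| <= M) ->
   forall (phi : 'rV[R]_d -> R),
     (exists M : R, forall x, `|phi x| <= M) ->
     (exists Lip : R, forall x y, `|phi x - phi y| <= Lip * enorm (x - y)) ->
   forall (p : R), 1 <= p ->
   forall (m0 : nat), (m <= m0 <= d)%N ->
     cond_rho p T0 rho -> cond_eta p T0 rho eta ->
   exists T : R, 0 < T <= T0 /\
     forall (d0 : measure_display) (Omega : measurableType d0) (P : probability Omega R)
       (tau : seq nat -> Omega -> R) (Ix : seq nat -> Omega -> {ffun 'I_m.+1 -> nat})
       (S : seq nat -> R -> Omega -> R) (B : seq nat -> R -> Omega -> 'rV[R]_d),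
       particle_family eta L q rho P tau Ix S B ->
       forall (t : R) (i : nat), 0 <= t <= T -> (i <= m0)%N ->
         (\int[P]_w ereal_sup
             [set (powR `|Hphi tau Ix S B q rho c phi T t x i w| p)%:E | x in [set: 'rV[R]_d]]
          < +oo)%E)
  /\
  (* Case p = 1 *)
  (forall (R : realType) (eta : R -> R), bernstein eta -> eta x @[x --> 0^'+] --> 0 ->
   cond_p1 eta ->
   forall (rho : R -> R), pos_density rho ->
   forall (T : R), 0 < T -> cond_rho 1 T rho /\ cond_eta 1 T rho eta).
Proof.
split.
  move=> R d _ eta eta_bern _ m _ L q _ q0 _ rho rho_pos T0 T00 c _ cb phi phib phiL
    p p1 m0 _ crho ceta.
  have [T [T0T HT]] :=
    exists_small_time_moment eta_bern q0 rho_pos T00 cb phib phiL p1 crho ceta.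
  exists T; split=> // d0 Omega P tau Ix S B pf t i tT _.
  exact: HT pf _ _ tT.
move=> R eta eta_bern _ ceta rho _ T _; exact: cond_p1_sufficient.
Qed.
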